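(* Fix $j\ge1$ and consider the $5x+1$ branching random walk $\mathcal B[5^j]$. For a realization $\omega$ let $L_k^*(\omega)$ be the position of the leftmost individual of generation $k$. Then $$\lim_{k\to\infty}\frac1k L_k^*(\omega)=\beta_{5,BP}\quad\text{almost surely},$$ where $\beta_{5,BP}$ is the unique $\beta>0$ with $\overline g_{5,BP}(\beta)=0$, and $$\overline g_{5,BP}(a)=-\sup_{\theta\le0}\Big(a\theta-\log\big(2^\theta+\tfrac15(\tfrac25)^\theta\big)\Big).$$ The constant $\beta_{5,BP}$ is the same for all $j\ge1$ (numerically $\beta_{5,BP}\approx0.01179816$).
   Context: The branching random walk $\mathcal B[5^j]$ ($j\ge1$): each individual has a type, a residue class $a \bmod 5^j$ with $a\not\equiv0\pmod 5$, and a position in $\mathbb R$. Generation $0$ consists of a single individual of type $1\bmod 5^j$ at a fixed initial position. Given generation $k-1$, each individual, independently of all others, of type $a$ at position $y$ produces offspring in generation $k$ as follows: choose $\tilde a$ uniformly at random among the $5$ residue classes mod $5^{j+1}$ reducing to $a$ mod $5^j$; produce one child of type $2\tilde a\bmod 5^j$ at position $y+\log 2$; and, if $2\tilde a\equiv1\pmod5$ and $(2\tilde a-1)/5\not\equiv0\pmod5$, produce in addition a second child of type $(2\tilde a-1)/5\bmod 5^j$ at position $y+\log(2/5)$. (This models backward iteration of $T_5(n)=(5n+1)/2$ for odd $n$, $n/2$ for even $n$, in the tree pruned of multiples of $5$, on a logarithmic scale.) *)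

(* Defs.v *)
From HB Require Import structures.
From mathcomp Require Import all_boot all_order all_algebra.
From mathcomp Require Import all_classical all_reals all_analysis.

Set Implicit Arguments.
Unset Strict Implicit.
Unset Printing Implicit Defensive.

Import Order.TTheory GRing.Theory Num.Theory.
Import numFieldNormedType.Exports.

Local Open Scope classical_set_scope.
Local Open Scope ring_scope.

(* Types are residue classes mod 5 ^ j, represented by their canonical
   representatives a < 5 ^ j; the five classes mod 5 ^ j.+1 reducing to a are
   then those of a + c * 5 ^ j for c = 0, ..., 4. *)
Definition lift5 (j a : nat) (c : 'I_5) : nat := (a + c * 5 ^ j)%N.

Definition type_fst (j at5 : nat) : nat := ((2 * at5) %% 5 ^ j)%N.

Definition has_snd (at5 : nat) : bool :=
  ((2 * at5) %% 5 == 1)%N && (((2 * at5).-1 %/ 5) %% 5 != 0)%N.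

Definition type_snd (j at5 : nat) : nat := (((2 * at5).-1 %/ 5) %% 5 ^ j)%N.

(* Potential individuals are words over bool, read from right to left:
   [false :: u] and [true :: u] are the first and the second child of u, and
   [::] is the root, of type 1 at position x0. [digit u] is the choice made by
   u for the lift of its type, and is irrelevant when u does not exist. The
   value is the (type, position) of u, or None if u does not exist. *)
Fixpoint individual (R : realType) (j : nat) (x0 : R) (digit : seq bool -> 'I_5)
    (u : seq bool) : option (nat * R) :=
  match u with
  | [::] => Some (1%N, x0)
  | b :: v =>
    match individual j x0 digit v with
    | None => None
    | Some (a, y) =>
      let at5 := lift5 j a (digit v) in
      if b then
        if has_snd at5 then Some (type_snd j at5, y + ln (2 / 5)) else None
      else Some (type_fst j at5, y + ln 2)
    end
  end.

Definition positions (R : realType) (j : nat) (x0 : R)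
    (digit : seq bool -> 'I_5) (k : nat) : set R :=
  [set y | exists u a, size u = k /\ individual j x0 digit u = Some (a, y)].

(* This infimum is a minimum, see leftmost_min below. *)
Definition leftmost (R : realType) (j : nat) (x0 : R)
    (digit : seq bool -> 'I_5) (k : nat) : R :=
  inf (positions j x0 digit k).

(* Every B i is allowed: E is meant to carry the discrete sigma-algebra (below,
   E is 'I_5). *)
Definition mutually_independent (R : realType) (d : measure_display)
    (T : measurableType d) (P : probability T R) (I : choiceType) (E : Type)
    (X : I -> T -> E) : Prop :=
  forall (s : seq I) (B : I -> set E), uniq s ->
    P (\bigcap_(i in [set` s]) (X i @^-1` B i)) =
    (\prod_(i <- s) P (X i @^-1` B i))%E.

Definition iid_uniform_digits (R : realType) (d : measure_display)
    (T : measurableType d) (P : probability T R)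
    (D : seq bool -> T -> 'I_5) : Prop :=
  [/\ forall u (B : set 'I_5), measurable (D u @^-1` B),
      forall u c, P (D u @^-1` [set c]) = (1 / 5)%:E &
      mutually_independent P D].

(* Extended-real valued, since the supremum is +oo for a < ln (2 / 5). *)
Definition gbar5BP (R : realType) (a : R) : \bar R :=
  (- ereal_sup [set (a * theta - ln (2 `^ theta + 1 / 5 * (2 / 5) `^ theta))%:E
               | theta in [set theta : R | (theta <= 0)%R]])%E.

Lemma individual_type (R : realType) (j : nat) (x0 : R) digit u a y :
  (0 < j)%N -> individual j x0 digit u = Some (a, y) ->
  (a < 5 ^ j)%N /\ (a %% 5 != 0)%N.
Proof.
case: j => // j _; elim: u a y => [|b u IH] a y /=.
  by case=> <- _; split=> //; rewrite expnS (@leq_trans (5 * 1)) // leq_mul2l expn_gt0.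
case: (individual _ _ _ u) IH => [[a' y']|] // /(_ _ _ erefl) [_ a'5].
have d5 : (5 %| 5 ^ j.+1)%N by rewrite expnS dvdn_mulr.
case: b => [|[<- _]].
  case: ifP => // /andP[_ h] [<- _].
  by rewrite /type_snd ltn_mod expn_gt0 modn_dvdm.
rewrite /type_fst ltn_mod expn_gt0 modn_dvdm //; split=> //.
rewrite -[_ == _]/(5 %| _)%N Gauss_dvdr // /lift5 dvdn_addl ?dvdn_mull //.
Qed.

Lemma leftmost_min (R : realType) (j : nat) (x0 : R) digit k :
  positions j x0 digit k (leftmost j x0 digit k) /\
  forall y, positions j x0 digit k y -> leftmost j x0 digit k <= y.
Proof.
pose pos (u : k.-tuple bool) := oapp snd 0 (individual j x0 digit u).
pose ex (u : k.-tuple bool) := individual j x0 digit u.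
have ne : ex (nseq_tuple k false).
  rewrite /ex /=; elim: k {pos ex} => //= k.
  by case: (individual _ _ _ _) => [[a y]|].
pose u0 := [arg min_(u < nseq_tuple k false | ex u) pos u]%O.
have [u0ex u0min] : ex u0 /\ forall u, ex u -> pos u0 <= pos u.
  by rewrite /u0; case: arg_minP.
have lb y : positions j x0 digit k y -> pos u0 <= y.
  move=> [u [a [/eqP su Hu]]].
  have := u0min (Tuple su); rewrite /ex /pos /= Hu; exact.
have in0 : positions j x0 digit k (pos u0).
  move: u0ex; rewrite /ex /pos; case E: (individual _ _ _ u0) => [[a y]|] // _.
  by exists u0, a; rewrite size_tuple.
suff -> : leftmost j x0 digit k = pos u0 by [].
apply/eqP; rewrite eq_le; apply/andP; split.
  by apply: ge_inf => //; exists (pos u0).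
by apply: lb_le_inf => //; exists (pos u0).
Qed.

(* Main.v *)
(* An individual of generation k with t second children in its ancestry sits at
   x0 + k ln 2 - t ln 5, so one studies M_k, the largest such t. A mean-matrix
   computation gives 'C(k, t) / 5 ^ t individuals in expectation when the root has
   a uniform type, because 2 is invertible mod 5 ^ j; hence M_k / k should tend to
   the p at which the exponential rate of this number vanishes, and by Legendre
   duality beta = ln 2 - p ln 5.
   The law of M_k satisfies a recursion over the first generation that only
   involves the types, so both bounds are statements about that recursion.
   Above p, a Chernoff bound is summable. Below p, the individuals of type 1
   having enough second children among their ancestors form, along multiples of a
   fixed generation, a supercritical Galton-Watson process (2 generates the units
   mod 5 ^ j, so type 1 is reached from everywhere); it survives with positive
   probability, and since every line of first children is infinite and keeps
   branching off new trials, the failure probability decays geometrically.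
   Borel-Cantelli concludes. *)
Require Import Defs.
From HB Require Import structures.
From mathcomp Require Import all_boot all_order all_algebra.
From mathcomp Require Import all_classical all_reals all_analysis.
From mathcomp Require Import ring lra zify.

Set Implicit Arguments.
Unset Strict Implicit.
Unset Printing Implicit Defensive.

Import Order.TTheory GRing.Theory Num.Theory.
Import numFieldNormedType.Exports.

Local Open Scope classical_set_scope.
Local Open Scope ring_scope.

(** * Doubling and second children modulo powers of 5 *)

Definition types (j : nat) : seq nat :=
  [seq a <- iota 0 (5 ^ j) | (a %% 5 != 0)%N].

Lemma mem_types j a : (a \in types j) = ((a %% 5 != 0) && (a < 5 ^ j))%N.
Proof. by rewrite mem_filter mem_iota. Qed.

Lemma uniq_types j : uniq (types j).
Proof. by rewrite filter_uniq // iota_uniq. Qed.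

Lemma dvdn_5_expn5 j : (0 < j)%N -> (5 %| 5 ^ j)%N.
Proof. by case: j => // j _; rewrite expnS dvdn_mulr. Qed.

Lemma one_in_types j : (0 < j)%N -> 1%N \in types j.
Proof. by move=> j0; rewrite mem_types /= -{1}(expn0 5) ltn_exp2l. Qed.

Lemma three_in_types j : (0 < j)%N -> 3%N \in types j.
Proof.
move=> j0; rewrite mem_types /= (@leq_trans (5 ^ 1)) //.
by rewrite leq_exp2l.
Qed.

Lemma type_fst_lift5 j a c : type_fst j (lift5 j a c) = ((2 * a) %% 5 ^ j)%N.
Proof. by rewrite /type_fst /lift5 mulnDr mulnA -modnDmr modnMl addn0. Qed.

Lemma coprime_5_neq0 a : (a %% 5 != 0)%N = coprime 5 a.
Proof. by rewrite prime_coprime. Qed.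

Lemma double_mod_types j a : (0 < j)%N -> (a %% 5 != 0)%N ->
  ((2 * a) %% 5 ^ j)%N \in types j.
Proof.
move=> j0 a5; rewrite mem_types ltn_mod expn_gt0 andbT modn_dvdm ?dvdn_5_expn5 //.
by move: a5; rewrite !coprime_5_neq0 coprimeMr.
Qed.

Lemma perm_double_types j : (0 < j)%N ->
  perm_eq [seq (2 * a) %% 5 ^ j | a <- types j]%N (types j).
Proof.
move=> j0.
have inj : {in types j &, injective (fun a => (2 * a) %% 5 ^ j)%N}.
  have c2 : coprime (5 ^ j) 2 by rewrite coprimeXl.
  move=> a b; rewrite !mem_types => /andP[_ la] /andP[_ lb] /eqP.
  wlog lab : a b la lb / (a <= b)%N.
    move=> H E; have [?|/ltnW ?] := leqP a b; first exact: H.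
    by apply/esym/H; rewrite // eq_sym.
  rewrite eq_sym eqn_mod_dvd; last by rewrite leq_mul2l.
  rewrite -mulnBr Gauss_dvdr // => /dvdnP[k E].
  have k0 : (k = 0)%N by nia.
  by move: E; rewrite k0; lia.
have U : uniq [seq (2 * a) %% 5 ^ j | a <- types j]%N.
  by rewrite map_inj_in_uniq ?uniq_types.
rewrite uniq_perm ?uniq_types //.
have [] := uniq_min_size U (s2 := types j) => [x /mapP[a]|| //].
  by rewrite mem_types => /andP[a5 _] ->; exact: double_mod_types.
by rewrite size_map.
Qed.

(** For n < 5^(j+1), the quotient (2n - 1) / 5 runs through the odd numbers below 2 * 5^j; as 5^j is
    odd, exactly one of b and b + 5^j is odd, so each type arises once. *)
Lemma perm_type_snd j : (0 < j)%N ->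
  perm_eq [seq type_snd j n | n <- iota 0 (5 ^ j.+1) & has_snd n] (types j).
Proof.
move=> j0.
have e5 : (5 ^ j.+1 = 5 * 5 ^ j)%N by rewrite expnS.
have od : odd (5 ^ j) by rewrite oddX orbT.
apply: uniq_perm (uniq_types j) _.
  rewrite map_inj_in_uniq ?filter_uniq ?iota_uniq //.
  move=> n m; rewrite !mem_filter !mem_iota !add0n /has_snd /type_snd e5.
  move=> /andP[/andP[/eqP n1 _] /= ln] /andP[/andP[/eqP m1 _] /= lm] E.
  have := divn_eq ((2 * n).-1 %/ 5) (5 ^ j).
  have := divn_eq ((2 * m).-1 %/ 5) (5 ^ j).
  rewrite E; move: (_ %% _)%N => r.
  set a := ((2 * m).-1 %/ 5 %/ _)%N; set b := ((2 * n).-1 %/ 5 %/ _)%N.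
  move: (5 ^ j)%N od ln lm => N od ln lm Hm Hn.
  have Em : (2 * m = 5 * (a * N + r) + 1)%N by lia.
  have En : (2 * n = 5 * (b * N + r) + 1)%N by lia.
  have la : (a < 2)%N.
    by rewrite ltnNge; apply/negP => ge2; have := leq_mul ge2 (leqnn N); lia.
  have lb : (b < 2)%N.
    by rewrite ltnNge; apply/negP => ge2; have := leq_mul ge2 (leqnn N); lia.
  have EN := odd_double_half N; rewrite od -muln2 in EN.
  clear Hm Hn; clearbody a b.
  by case: a b la lb Em En => [|[|?]] [|[|?]] // _ _; lia.
move=> b; apply/mapP/idP => [[n]|].
  rewrite mem_filter => /andP[/andP[_ h] _] ->.
  by rewrite mem_types /type_snd ltn_mod expn_gt0 andbT modn_dvdm ?dvdn_5_expn5.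
rewrite mem_types => /andP[b5 lb].
have [ob|eb] := boolP (odd b).
  exists ((5 * b + 1) %/ 2)%N; last first.
    rewrite /type_snd; suff -> : ((2 * ((5 * b + 1) %/ 2)).-1 %/ 5 = b)%N by rewrite modn_small.
    by lia.
  rewrite mem_filter mem_iota /has_snd e5 add0n; apply/andP; split; last by lia.
  suff -> : ((2 * ((5 * b + 1) %/ 2)) = 5 * b + 1)%N by rewrite addn1 /= mulKn // b5 andbT; lia.
  by lia.
have E : (2 * ((5 * (b + 5 ^ j) + 1) %/ 2) = 5 * (b + 5 ^ j) + 1)%N by lia.
exists ((5 * (b + 5 ^ j) + 1) %/ 2)%N; last first.
  by rewrite /type_snd E addn1 /= mulKn // modnDr modn_small.
rewrite mem_filter mem_iota /has_snd E add0n e5 addn1 /= mulKn //.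
rewrite -modnDmr (eqP (dvdn_5_expn5 j0)) addn0 b5 andbT; apply/andP; split; by lia.
Qed.

(** Lifting the exponent: the fifth power of 1 + 5^(j+1) u is 1 + 5^(j+2) u' with u' = u modulo
    5. *)
Lemma exp2_order_mod5 j : exists2 u, (u %% 5 != 0)%N &
  (2 ^ (4 * 5 ^ j) = 1 + 5 ^ j.+1 * u)%N.
Proof.
elim: j => [|j [u u5 E]]; first by exists 3%N.
(* Read off the binomial expansion of [(1 + 5 ^ j.+1 * u) ^ 5]. *)
exists (u + 5 * (2 * 5 ^ j * u ^ 2 + 10 * (5 ^ j) ^ 2 * u ^ 3
   + 25 * (5 ^ j) ^ 3 * u ^ 4 + 25 * (5 ^ j) ^ 4 * u ^ 5))%N.
  by rewrite -modnDmr modnMr addn0.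
rewrite expnS mulnCA mulnC expnM E !(expnS _ j.+1) !(expnS _ j).
by rewrite !expnS !expn0; ring.
Qed.

(** Successive approximation: an exponent valid modulo 5^(j+1) is corrected by l times 4 * 5^j,
    which by [exp2_order_mod5] adds l u x to the next base-5 digit. *)
Lemma exp2_transitive_mod5 j a b : (a %% 5 != 0)%N -> (b %% 5 != 0)%N ->
  exists i, (2 ^ i * a = b %[mod 5 ^ j.+1])%N.
Proof.
move=> a5 b5; elim: j => [|j [i E]].
  rewrite expn1; have [i Ei] : exists i, ((2 ^ i * (a %% 5)) %% 5 = b %% 5)%N.
    move: a5 b5 (ltn_pmod a (isT : 0 < 5)%N) (ltn_pmod b (isT : 0 < 5)%N).
    case: (a %% 5)%N => [|[|[|[|[|?]]]]] //; case: (b %% 5)%N => [|[|[|[|[|?]]]]] // _ _ _ _;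
    by [exists 0%N|exists 1%N|exists 2%N|exists 3%N].
  by exists i; rewrite -modnMmr.
have [u u5 Eu] := exp2_order_mod5 j.
set x := (2 ^ i * a)%N in E.
have x5 : (x %% 5 != 0)%N by rewrite coprime_5_neq0 coprimeMr -!coprime_5_neq0 a5 coprime_5_neq0 coprimeXr.
have [m Em] : exists m, (x + 5 ^ j.+1 * m = b %[mod 5 ^ j.+2])%N.
  (* Adding [5 ^ j.+2 * x] keeps the residue of b and makes the subtraction of x exact in nat. *)
  have le : (x <= b + 5 ^ j.+2 * x)%N by rewrite (leq_trans _ (leq_addl _ _)) // leq_pmull // expn_gt0.
  have : (5 ^ j.+1 %| b + 5 ^ j.+2 * x - x)%N.
    rewrite -eqn_mod_dvd // -modnDmr expnS mulnAC -modnMmr modnn muln0 mod0n addn0.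
    by rewrite E.
  move=> /dvdnP[m Em]; exists m; rewrite mulnC -Em subnKC // -modnDmr modnMr addn0 //.
have [l El] : exists l, (l * (u * x) = m %[mod 5])%N.
  have ux : ((u * x) %% 5 != 0)%N by rewrite coprime_5_neq0 coprimeMr -!coprime_5_neq0 u5.
  have [l El] : exists l, ((l * ((u * x) %% 5)) %% 5 = m %% 5)%N.
    move: ux (ltn_pmod (u * x) (isT : 0 < 5)%N) (ltn_pmod m (isT : 0 < 5)%N).
    case: (_ %% 5)%N => [|[|[|[|[|?]]]]] //; case: (m %% 5)%N => [|[|[|[|[|?]]]]] // _ _ _;
    by [exists 0%N|exists 1%N|exists 2%N|exists 3%N|exists 4%N].
  by exists l; rewrite -modnMmr.
exists (4 * 5 ^ j * l + i)%N; rewrite -Em expnD -mulnA -/x expnM Eu.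
have Eg : ((1 + 5 ^ j.+1 * u) ^ l = 1 + 5 ^ j.+1 * (l * u) %[mod 5 ^ j.+2])%N.
  elim: l {El} => [|l IH]; first by rewrite mul0n muln0.
  rewrite expnS -modnMmr IH modnMmr.
  have -> : ((1 + 5 ^ j.+1 * u) * (1 + 5 ^ j.+1 * (l * u)) =
     5 ^ j * (u * (l * u)) * 5 ^ j.+2 + (1 + 5 ^ j.+1 * (l.+1 * u)))%N.
    by rewrite !(expnS _ j.+1) !(expnS _ j); ring.
  by rewrite modnMDl.
rewrite -modnMml Eg modnMml mulnDl mul1n -mulnA -mulnA -modnDmr -[in RHS]modnDmr.
congr ((_ + _) %% _)%N.
by rewrite !(expnSr _ j.+1) -!muln_modr El.
Qed.

(** The bound is the order of the unit group modulo 5^j; it makes the waiting time for a prescribed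
    type uniform. *)
Lemma double_transitive_types j a b : (0 < j)%N -> a \in types j ->
  b \in types j ->
  exists2 i, (i < 4 * 5 ^ j.-1)%N & ((2 ^ i * a) %% 5 ^ j = b)%N.
Proof.
case: j => // j _; rewrite !mem_types => /andP[a5 _] /andP[b5 lb] /=.
have [i E] := exp2_transitive_mod5 j a5 b5.
have [u _ Eu] := exp2_order_mod5 j.
have Eu1 : (2 ^ (4 * 5 ^ j) = 1 %[mod 5 ^ j.+1])%N.
  by rewrite Eu -modnDmr modnMr addn0.
exists (i %% (4 * 5 ^ j))%N; first by rewrite ltn_mod muln_gt0 expn_gt0.
rewrite -(modn_small lb) -E {2}(divn_eq i (4 * 5 ^ j)) expnD.
rewrite -mulnA mulnC -[in RHS]modnMml mulnC [in RHS]mulnC (mulnC _ (4 * _))%N expnM.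
by rewrite -modnXm Eu1 modnXm exp1n modnMmr muln1.
Qed.

(** * Recursions over the first generation: Chernoff bound and survival *)

Section ExtinctionRecursion.
Variables (R : realType) (j : nat).
Hypothesis j_gt0 : (0 < j)%N.

(* The probability that no individual of generation k descending from an
   individual of type a has at least m second children among its ancestors. *)
Fixpoint miss (k a m : nat) : R :=
  match k with
  | 0 => (0 < m)%N%:R
  | k'.+1 => 5^-1 * \sum_(c < 5)
      miss k' (type_fst j (lift5 j a c)) m *
      (if has_snd (lift5 j a c) then miss k' (type_snd j (lift5 j a c)) m.-1
       else 1)
  end.

Lemma missSE k a m : miss k.+1 a m = 5^-1 * \sum_(c < 5)
  miss k (type_fst j (lift5 j a c)) m *
  (if has_snd (lift5 j a c) then miss k (type_snd j (lift5 j a c)) m.-1 else 1).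
Proof. by []. Qed.

Lemma avg5_le (f g : 'I_5 -> R) : (forall c, f c <= g c) ->
  5^-1 * \sum_(c < 5) f c <= 5^-1 * \sum_(c < 5) g c.
Proof. by move=> fg; rewrite ler_pM2l ?invr_gt0 // ler_sum. Qed.

Lemma avg5_const (x : R) : 5^-1 * \sum_(c < 5) x = x.
Proof. by rewrite sumr_const card_ord -[x *+ _]mulr_natl mulKf // pnatr_eq0. Qed.

Lemma miss_ge0 k a m : 0 <= miss k a m.
Proof.
elim: k a m => [|k IH] a m; first exact: ler0n.
rewrite mulr_ge0 ?invr_ge0 // sumr_ge0 // => c _; rewrite mulr_ge0 //.
by case: ifP.
Qed.

Lemma miss_le1 k a m : miss k a m <= 1.
Proof.
elim: k a m => [|k IH] a m; first by rewrite /= lern1 leq_b1.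
rewrite -[leRHS]avg5_const; apply: avg5_le => c.
by rewrite mulr_ile1 // ?miss_ge0 //; case: ifP => // _; rewrite miss_ge0.
Qed.

Let snd_factor_ge0 k n m :
  0 <= (if has_snd n then miss k (type_snd j n) m else 1).
Proof. by case: ifP => _; rewrite ?miss_ge0. Qed.

Let snd_factor_le1 k n m :
  (if has_snd n then miss k (type_snd j n) m else 1) <= 1.
Proof. by case: ifP => _; rewrite ?miss_le1. Qed.

Lemma miss_mono k a m m' : (m <= m')%N -> miss k a m <= miss k a m'.
Proof.
elim: k a m m' => [|k IH] a m m' mm'.
  by rewrite /= ler_nat; case: m mm' => // m; case: m'.
apply: avg5_le => c; apply: ler_pM; rewrite ?miss_ge0 ?IH //.
by case: ifP => // _; apply: IH; lia.
Qed.

(** All lifts of a give the same type of first child, so discarding the second child removes the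
    average. *)
Lemma missS_double k a m : miss k.+1 a m <= miss k ((2 * a) %% 5 ^ j) m.
Proof.
rewrite -[leRHS]avg5_const; apply: avg5_le => c.
by rewrite type_fst_lift5 ler_piMr ?miss_ge0.
Qed.

(** A first child carries over its parent's count, so a threshold once reached stays reached. *)
Lemma missS k a m : miss k.+1 a m <= miss k a m.
Proof.
elim: k a m => [|k IH] a m; first exact: missS_double.
rewrite [in leRHS]/= [leLHS]/=; apply: avg5_le => c; apply: ler_pM => //.
- exact: (miss_ge0 k.+1).
- exact: (snd_factor_ge0 k.+1).
- exact: IH.
by case: ifP => // _; exact: IH.
Qed.

Lemma miss_addl i k a m : miss (i + k) a m <= miss k a m.
Proof. by elim: i => // i IH; exact: le_trans (missS _ _ _) IH. Qed.

Lemma miss_double_iter i k a m : (a < 5 ^ j)%N ->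
  miss (i + k) a m <= miss k ((2 ^ i * a) %% 5 ^ j) m.
Proof.
elim: i a => [|i IH] a la; first by rewrite mul1n modn_small.
apply: le_trans (missS_double _ _ _) _; apply: le_trans (IH _ _) _.
  by rewrite ltn_mod expn_gt0.
by rewrite modnMmr mulnA expnSr.
Qed.

Lemma sum_iota_lift5 (h : nat -> R) :
  \sum_(n <- iota 0 (5 ^ j.+1)) h n =
  \sum_(a <- iota 0 (5 ^ j)) \sum_(c < 5) h (lift5 j a c).
Proof.
rewrite exchange_big /= !big_ord_recr big_ord0 /= add0r /lift5.
have sh c : \sum_(a <- iota 0 (5 ^ j)) h (a + c * 5 ^ j)%N =
    \sum_(c * 5 ^ j <= n < c.+1 * 5 ^ j) h n.
  rewrite -[X in iota 0 X]subn0 -/(index_iota 0 (5 ^ j)) -{2}[(c * _)%N]add0n.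
  by rewrite big_addn mulSn addnK.
rewrite !sh -!big_cat_nat ?leq_mul2r ?orbT //=.
by rewrite expnS mul0n /index_iota subn0.
Qed.

(* The uniform distribution on the types is a left eigenvector of the mean
   matrix. *)
Lemma sum_types_offspring (f g : nat -> R) :
  \sum_(a <- types j) 5^-1 * \sum_(c < 5) (f (type_fst j (lift5 j a c)) +
      (if has_snd (lift5 j a c) then g (type_snd j (lift5 j a c)) else 0)) =
  \sum_(a <- types j) f a + 5^-1 * \sum_(a <- types j) g a.
Proof.
transitivity (\sum_(a <- types j) f ((2 * a) %% 5 ^ j)%N +
  5^-1 * \sum_(a <- types j) \sum_(c < 5)
   (if has_snd (lift5 j a c) then g (type_snd j (lift5 j a c)) else 0)).
  rewrite mulr_sumr -big_split /=; apply: eq_bigr => a _.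
  under eq_bigr do rewrite type_fst_lift5.
  by rewrite big_split mulrDr /= avg5_const.
congr (_ + _ * _).
  rewrite -(big_map (fun a => (2 * a) %% 5 ^ j)%N predT f).
  by rewrite (perm_big _ (perm_double_types j_gt0)).
rewrite -[RHS](perm_big _ (perm_type_snd j_gt0)) big_map big_filter [RHS]big_mkcond /=.
rewrite sum_iota_lift5.
(* Classes divisible by 5 contribute nothing: [has_snd] needs 2 n = 1 modulo 5. *)
rewrite big_filter big_mkcond /=; apply: eq_bigr => a _; case: ifPn => // a5.
rewrite big1 // => c _; rewrite /has_snd; case: ifPn => // /andP[/eqP h _].
move: a5 h; rewrite negbK /lift5 => /eqP a5; rewrite mulnDr mulnCA.
by have /dvdnP[N ->] := dvdn_5_expn5 j_gt0; lia.
Qed.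

(** Chernoff bound: in the expected sum of z^t over individuals with t second children, a first
    child contributes the factor 1 and a second child z / 5. The inductive step is a union bound
    over the two children, averaged by [sum_types_offspring]. *)
Lemma sum_types_hit (z : R) k m : 1 <= z ->
  (\sum_(a <- types j) (1 - miss k a m)) * z ^+ m <=
  (size (types j))%:R * (1 + z / 5) ^+ k.
Proof.
move=> z1; have z0 : 0 <= z by rewrite (le_trans _ z1).
have triv k' m' : \sum_(a <- types j) (1 - miss k' a m') <= (size (types j))%:R.
  rewrite (le_trans (ler_sum _ (G := fun=> 1) _)) => [//|a _|].
    by rewrite lerBlDr lerDl miss_ge0.
  by rewrite big_const_seq count_predT iter_addr_0.
have q0 : 0 <= (size (types j))%:R :> R by exact: ler0n.
elim: k m => [|k IH] [|m].
- by rewrite !expr0 !mulr1.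
- rewrite /= subrr big1_eq mul0r mulr_ge0 // exprn_ge0 //.
- rewrite expr0 mulr1; apply: le_trans (triv _ _) _.
  by rewrite ler_peMr // exprn_ege1 // lerDl divr_ge0.
have step : \sum_(a <- types j) (1 - miss k.+1 a m.+1) <=
    \sum_(a <- types j) (1 - miss k a m.+1) + 5^-1 * \sum_(a <- types j) (1 - miss k a m).
  rewrite -sum_types_offspring; apply: ler_sum => a _.
  rewrite missSE -[X in X - _]avg5_const -mulrBr -sumrB; apply: avg5_le => c.
  have := miss_ge0 k (type_fst j (lift5 j a c)) m.+1.
  have := miss_le1 k (type_fst j (lift5 j a c)) m.+1.
  case: ifP => _ /=; last by lra.
  have := miss_ge0 k (type_snd j (lift5 j a c)) m.
  have := miss_le1 k (type_snd j (lift5 j a c)) m.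
  by nra.
apply: le_trans (ler_wpM2r (exprn_ge0 _ z0) step) _.
have := IH m.+1; have := ler_wpM2l (divr_ge0 z0 (ler0n _ 5)) (IH m).
rewrite !exprS; move: (z ^+ m) ((_ + _) ^+ k) => Z W.
move: (\sum_(a <- types j) (1 - miss k a m)) => s1.
move: (\sum_(a <- types j) (1 - miss k a m.+1)) => s2.
by lra.
Qed.

(* The mean number, and the probability generating function, of the individuals
   of type 1 in generation k descending from an individual of type a through at
   least r second children. *)
Fixpoint mean_ones (k a r : nat) : R :=
  match k with
  | 0 => ((a == 1) && (r == 0))%N%:R
  | k'.+1 => 5^-1 * \sum_(c < 5)
      (mean_ones k' (type_fst j (lift5 j a c)) r +
      (if has_snd (lift5 j a c)
       then mean_ones k' (type_snd j (lift5 j a c)) r.-1 else 0))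
  end.

Fixpoint pgf_ones (k a r : nat) (x : R) : R :=
  match k with
  | 0 => if ((a == 1) && (r == 0))%N then x else 1
  | k'.+1 => 5^-1 * \sum_(c < 5)
      pgf_ones k' (type_fst j (lift5 j a c)) r x *
      (if has_snd (lift5 j a c)
       then pgf_ones k' (type_snd j (lift5 j a c)) r.-1 x else 1)
  end.

Lemma mean_ones_ge0 k a r : 0 <= mean_ones k a r.
Proof.
elim: k a r => [|k IH] a r; first exact: ler0n.
rewrite mulr_ge0 ?invr_ge0 // sumr_ge0 // => c _; rewrite addr_ge0 //.
by case: ifP.
Qed.

Lemma mean_ones_le k a r : mean_ones k a r <= 2 ^+ k.
Proof.
elim: k a r => [|k IH] a r; first by rewrite /= lern1 leq_b1.
rewrite -[leRHS]avg5_const; apply: avg5_le => c.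
by rewrite exprS mulr_natl mulr2n lerD //; case: ifP => // _; rewrite exprn_ge0.
Qed.

Lemma mean_ones_double k a r : mean_ones k ((2 * a) %% 5 ^ j) r <= mean_ones k.+1 a r.
Proof.
rewrite -[leLHS]avg5_const; apply: avg5_le => c.
by rewrite type_fst_lift5 lerDl; case: ifP => // _; rewrite mean_ones_ge0.
Qed.

Lemma mean_ones_double_iter i k a r : (a < 5 ^ j)%N ->
  mean_ones k ((2 ^ i * a) %% 5 ^ j) r <= mean_ones (i + k) a r.
Proof.
elim: i a => [|i IH] a la; first by rewrite mul1n modn_small.
apply: le_trans _ (mean_ones_double _ _ _); apply: le_trans _ (IH _ _).
  by rewrite modnMmr mulnA expnSr.
by rewrite ltn_mod expn_gt0.
Qed.

(** Pascal's rule along [sum_types_offspring]. Only an inequality, since the binomial counts exactly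
    r second children and [mean_ones] at least r. *)
Lemma sum_types_mean_ones k r :
  'C(k, r)%:R / 5 ^+ r <= \sum_(a <- types j) mean_ones k a r.
Proof.
elim: k r => [|k IH] r.
  rewrite (bigD1_seq 1%N) ?one_in_types ?uniq_types //= bin0n.
  case: r => [|r] /=; last by rewrite mul0r add0r sumr_ge0.
  by rewrite expr0 divr1 lerDl sumr_ge0.
rewrite (sum_types_offspring (mean_ones k ^~ r) (mean_ones k ^~ r.-1)).
case: r => [|r].
  have := IH 0%N; rewrite !bin0 => H0; apply: le_trans H0 _; rewrite lerDl.
  by rewrite mulr_ge0 ?invr_ge0 // sumr_ge0 // => a _; exact: mean_ones_ge0.
rewrite binS natrD mulrDl; apply: lerD => //.
by rewrite exprS invfM mulrCA ler_wpM2l ?invr_ge0.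
Qed.

Lemma pgf_ones_ge0 k a r x : 0 <= x -> 0 <= pgf_ones k a r x.
Proof.
move=> x0; elim: k a r => [|k IH] a r; first by rewrite /=; case: ifP.
rewrite mulr_ge0 ?invr_ge0 // sumr_ge0 // => c _; rewrite mulr_ge0 //.
by case: ifP.
Qed.

Lemma pgf_ones_mono k a r x y : 0 <= x -> x <= y ->
  pgf_ones k a r x <= pgf_ones k a r y.
Proof.
move=> x0 xy; elim: k a r => [|k IH] a r; first by rewrite /=; case: ifP.
apply: avg5_le => c; apply: ler_pM; rewrite ?pgf_ones_ge0 ?IH //.
  by case: ifP => // _; rewrite pgf_ones_ge0.
by case: ifP.
Qed.

(** In generation k only the individuals of type 1 with at least r second children are kept; each
    starts an independent copy, and all copies have to fail to gain s more. *)
Lemma miss_le_pgf_ones k l a r s :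
  miss (k + l) a (r + s) <= pgf_ones k a r (miss l 1 s).
Proof.
elim: k a r => [|k IH] a r.
  rewrite /=; case: ifP => [/andP[/eqP-> /eqP->] //|_]; exact: miss_le1.
apply: avg5_le => c; apply: ler_pM; rewrite ?miss_ge0 ?IH //.
case: ifP => // _; apply: le_trans (IH _ _); apply: miss_mono; lia.
Qed.

(** Taylor bound at 1, uniform in type and threshold; its form is stable under products and
    averages. *)
Lemma pgf_ones_quadratic k : exists2 C, 0 <= C & forall a r h, 0 <= h <= 1 ->
  pgf_ones k a r (1 - h) <= 1 - mean_ones k a r * h + C * h ^+ 2.
Proof.
elim: k => [|k [C C0 IH]].
  exists 0 => // a r h /andP[h0 h1] /=; case: ifP => _ /=; rewrite ?mul0r addr0 ?mul1r //.
  by rewrite subr0.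
(* Expanding a product of two such bounds leaves 2 C h^2, a product of two means at most 2^k each,
   and C^2 h^4 <= C^2 h^2; the cubic term is nonpositive. *)
exists (2 * C + 4 ^+ k + C ^+ 2); first by rewrite !addr_ge0 ?mulr_ge0 ?exprn_ge0.
move=> a r h /andP[h0 h1] /=.
have h01 : 0 <= h <= 1 by rewrite h0.
have p0 b s : 0 <= pgf_ones k b s (1 - h) by rewrite pgf_ones_ge0 ?subr_ge0.
set C' := (X in X * h ^+ 2).
suff key c : pgf_ones k (type_fst j (lift5 j a c)) r (1 - h) *
      (if has_snd (lift5 j a c)
       then pgf_ones k (type_snd j (lift5 j a c)) r.-1 (1 - h) else 1) <=
    1 + C' * h ^+ 2 - (mean_ones k (type_fst j (lift5 j a c)) r +
      (if has_snd (lift5 j a c)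
       then mean_ones k (type_snd j (lift5 j a c)) r.-1 else 0)) * h.
  apply: le_trans (avg5_le key) _.
  by rewrite sumrB mulrBr avg5_const -mulr_suml; lra.
have := IH (type_fst j (lift5 j a c)) r h h01; have := p0 (type_fst j (lift5 j a c)) r.
have := mean_ones_ge0 k (type_fst j (lift5 j a c)) r.
have := mean_ones_le k (type_fst j (lift5 j a c)) r.
move: (pgf_ones _ _ _ _) (mean_ones _ _ _) => p1 m1 m1le m10 p10 p1le.
have h2 : 0 <= h ^+ 2 by rewrite exprn_ge0.
have e4 : 4 ^+ k = 2 ^+ k * 2 ^+ k :> R by rewrite -exprMn; congr (_ ^+ _); lra.
have k4 : 0 <= 4 ^+ k :> R by rewrite exprn_ge0.
case: ifP => _; last first.
  rewrite mulr1 addr0 /C'; have : 0 <= (C + 4 ^+ k + C ^+ 2) * h ^+ 2.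
    by rewrite mulr_ge0 ?addr_ge0 ?exprn_ge0.
  by lra.
have := IH (type_snd j (lift5 j a c)) r.-1 h h01; have := p0 (type_snd j (lift5 j a c)) r.-1.
have := mean_ones_ge0 k (type_snd j (lift5 j a c)) r.-1.
have := mean_ones_le k (type_snd j (lift5 j a c)) r.-1.
move: (pgf_ones _ _ _ _) (mean_ones _ _ _) => p2 m2 m2le m20 p20 p2le.
apply: le_trans (ler_pM p10 p20 p1le p2le) _.
have mm : m1 * m2 * h ^+ 2 <= 4 ^+ k * h ^+ 2 by rewrite e4 ler_wpM2r // ler_pM.
have hh : h ^+ 4 <= h ^+ 2 by rewrite ler_wiXn2l.
have cc : C ^+ 2 * h ^+ 4 <= C ^+ 2 * h ^+ 2 by rewrite ler_wpM2l // exprn_ge0.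
have c3 : 0 <= (m1 + m2) * C * h ^+ 3 by rewrite !mulr_ge0 ?addr_ge0 ?exprn_ge0.
have -> : (1 - m1 * h + C * h ^+ 2) * (1 - m2 * h + C * h ^+ 2) =
  1 - (m1 + m2) * h + 2 * C * h ^+ 2 + m1 * m2 * h ^+ 2 - (m1 + m2) * C * h ^+ 3
   + C ^+ 2 * h ^+ 4 by ring.
by rewrite /C'; lra.
Qed.

(** Survival of a supercritical Galton-Watson process: when the mean exceeds 1, the generating
    function maps [0, 1 - h] into itself for small h. *)
Lemma miss_bounded K r : 1 < mean_ones K 1 r ->
  exists2 s, 0 <= s < 1 & forall n, miss (n * K) 1 (n * r) <= s.
Proof.
move=> m1; have [C C0 HC] := pgf_ones_quadratic K.
set M := mean_ones K 1 r in m1.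
(* This makes 1 - M h + C h^2 <= 1 - h; adding 1 to C avoids a zero denominator. *)
pose h := Num.min 1 ((M - 1) / (C + 1)).
have C1 : 0 < C + 1 by lra.
have hpos : 0 < h by rewrite lt_min ltr01 divr_gt0 ?subr_gt0.
have h1 : h <= 1 by rewrite ge_min lexx.
have hC : (C + 1) * h <= M - 1.
  by rewrite mulrC -ler_pdivlMr // ge_min lexx orbT.
exists (1 - h); first by rewrite subr_ge0 h1 /= ltrBlDr ltrDl.
elim=> [|n IH]; first by rewrite /= subr_ge0.
rewrite !mulSn; apply: le_trans (miss_le_pgf_ones _ _ _ _ _) _.
apply: le_trans (pgf_ones_mono _ _ _ (miss_ge0 _ _ _) IH) _.
apply: le_trans (HC _ _ _ _) _; first by rewrite (ltW hpos).
by rewrite -/M; nra.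
Qed.

(* Within one period the line of first children meets type 3, which has two
   children with probability at least 1 / 5. *)
Lemma miss_square k m x : (forall a, a \in types j -> miss k a m <= x) ->
  0 <= x <= 1 ->
  forall a, a \in types j -> miss (4 * 5 ^ j.-1 + k) a m <= x * (4 / 5 + x / 5).
Proof.
move=> Hx /andP[x0 x1] a aT.
have le1 i b : b \in types j -> miss (i + k) b m <= x.
  by move=> bT; apply: le_trans (miss_addl _ _ _ _) (Hx _ bT).
have [i li Ei] := double_transitive_types j_gt0 aT (three_in_types j_gt0).
have -> : (4 * 5 ^ j.-1 + k = i + (4 * 5 ^ j.-1 - i.+1 + k).+1)%N by lia.
move: (_ - _)%N => l.
have la : (a < 5 ^ j)%N by move: aT; rewrite mem_types => /andP[].
apply: le_trans (miss_double_iter _ _ _ la) _; rewrite Ei.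
(* The lift of 3 with c = 0 is 3 itself, and (2 * 3 - 1) / 5 = 1 is a second child. *)
pose c0 : 'I_5 := ord0.
have h0 : has_snd (lift5 j 3 c0) by rewrite /lift5 mul0n.
have T1 : ((2 * 3) %% 5 ^ j)%N \in types j by exact: double_mod_types.
have T2 : type_snd j (lift5 j 3 c0) \in types j.
  rewrite /lift5 mul0n addn0 /type_snd /= mem_types ltn_mod expn_gt0 andbT.
  by rewrite modn_dvdm ?dvdn_5_expn5.
rewrite missSE (bigD1 c0) // h0.
apply: (@le_trans _ _ (5^-1 * (x * x + \sum_(c < 5 | c != c0) x))).
  rewrite ler_wpM2l ?invr_ge0 // lerD //.
    rewrite type_fst_lift5 ler_pM ?miss_ge0 ?le1 //.
    by apply: le_trans (miss_mono _ _ (leq_pred m)) (le1 _ _ T2).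
  apply: ler_sum => c _; rewrite type_fst_lift5 -[leRHS]mulr1.
  by rewrite ler_pM ?miss_ge0 ?le1.
rewrite sumr_const cardC1 card_ord; have -> : x *+ 5.-1 = 4 * x by rewrite mulr_natl.
by lra.
Qed.

(** From any type, one period reaches type 1, and n blocks of length K then fail with probability at
    most s; each of n preceding periods multiplies the failure bound by [rho]. *)
Lemma miss_decay K r : 1 < mean_ones K 1 r ->
  exists2 rho, 0 <= rho < 1 & forall n,
    miss (n * (K + 4 * 5 ^ j.-1) + 4 * 5 ^ j.-1) 1 (n * r) <= rho ^+ n.
Proof.
move=> /miss_bounded[s /andP[s0 s1] Hs]; set q := (4 * _)%N.
(* The factor of [miss_square] at x = s, which dominates it at every x <= s. *)
exists (4 / 5 + s / 5); first by lra.
set rho := 4 / 5 + s / 5; have rho01 : 0 <= rho <= 1 by rewrite /rho; lra.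
have base n a : a \in types j -> miss (q + n * K) a (n * r) <= s.
  move=> aT; have [i li Ei] := double_transitive_types j_gt0 aT (one_in_types j_gt0).
  have -> : (q + n * K = (q - i) + (i + n * K))%N by rewrite /q; lia.
  apply: le_trans (miss_addl _ _ _ _) _.
  have la : (a < 5 ^ j)%N by move: aT; rewrite mem_types => /andP[].
  by apply: le_trans (miss_double_iter _ _ _ la) _; rewrite Ei.
have iter n l a : a \in types j -> miss (l * q + (q + n * K)) a (n * r) <= s * rho ^+ l.
  elim: l a => [|l IH] a aT; first by rewrite mulr1 base.
  have b01 : 0 <= s * rho ^+ l <= s.
    case/andP: rho01 => r0 r1.
    by rewrite mulr_ge0 ?exprn_ge0 //= ler_piMr // exprn_ile1.
  rewrite mulSn -addnA; apply: le_trans (miss_square IH _ aT) _; first by lra.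
  by rewrite exprSr mulrA ler_wpM2l ?/rho; lra.
move=> n; have -> : (n * (K + q) + q = n * q + (q + n * K))%N by lia.
apply: le_trans (iter _ _ _ (one_in_types j_gt0)) _.
by case/andP: rho01 => r0 r1; rewrite ler_piMl ?exprn_ge0 //; exact: ltW.
Qed.

(** Pigeonhole: some type a has mean above 1, and the line of first children leads from type 1 to a
    within one period. *)
Lemma mean_ones_large k r : 'C(k, r)%:R / 5 ^+ r > (size (types j))%:R :> R ->
  exists2 i, (i < 4 * 5 ^ j.-1)%N & 1 < mean_ones (i + k) 1 r.
Proof.
move=> Hk.
have [a aT Ha] : exists2 a, a \in types j & 1 < mean_ones k a r.
  apply: contrapT => H; have : \sum_(a <- types j) mean_ones k a r <= (size (types j))%:R.
    rewrite -sum1_size natr_sum big_seq [leRHS]big_seq; apply: ler_sum => a aT.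
    by rewrite leNgt; apply/negP => ?; apply: H; exists a.
  by apply/negP; rewrite -ltNge (lt_le_trans Hk) // sum_types_mean_ones.
have [i li Ei] := double_transitive_types j_gt0 (one_in_types j_gt0) aT.
exists i => //; apply: lt_le_trans Ha _; rewrite -{1}Ei.
have := one_in_types j_gt0; rewrite mem_types => /andP[_ l1].
exact: mean_ones_double_iter.
Qed.

End ExtinctionRecursion.

(** * The rate function, Stirling bounds and Legendre duality *)

Section RateFunction.
Variable R : realType.
Implicit Types p z : R.

(* By Stirling, [expR (k * rate p)] is the exponential order of the expected
   number ['C(k, t) / 5 ^ t], with [t = p * k], of individuals of generation k
   with t second children in their ancestry. *)
Definition rate p : R := - (p * ln (5 * p)) - (1 - p) * ln (1 - p).

Lemma ln_ge_1subV (y : R) : 0 < y -> 1 - y^-1 <= ln y.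
Proof.
move=> y0; have iy : 0 < y^-1 by rewrite invr_gt0.
have /le_ln1Dx : -1 < y^-1 - 1 by lra.
by rewrite addrC subrK lnV // lerNl opprB.
Qed.

(** Gibbs' inequality between the Bernoulli laws of parameters p and (z / 5) / (1 + z / 5): ln y >=
    1 - 1 / y is applied to both likelihood ratios, and the weighted bounds cancel. *)
Lemma rate_le p z : 0 < p < 1 -> 0 < z -> rate p <= ln (1 + z / 5) - p * ln z.
Proof.
move=> /andP[p0 p1] z0; set Z := 1 + z / 5.
have Z0 : 0 < Z by rewrite /Z; lra.
have q0 : 0 < 1 - p by lra.
have p5 : 0 < 5 * p by lra.
have A := ln_ge_1subV (divr_gt0 (mulr_gt0 p5 Z0) z0).
have B := ln_ge_1subV (mulr_gt0 q0 Z0).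
rewrite ln_div ?posrE ?mulr_gt0 // lnM ?posrE // in A.
rewrite lnM ?posrE // in B.
have := lerD (ler_wpM2l (ltW p0) A) (ler_wpM2l (ltW q0) B).
have -> : p * (1 - (5 * p * Z / z)^-1) + (1 - p) * (1 - ((1 - p) * Z)^-1) = 0.
  have Z1 : Z != 0 by rewrite gt_eqF.
  have -> : z = 5 * (Z - 1) by rewrite /Z; lra.
  by field; rewrite !gt_eqF // /Z; lra.
by rewrite /rate; lra.
Qed.

(* The minimiser of [z |-> ln (1 + z / 5) - p * ln z]. *)
Definition opt_weight p : R := 5 * p / (1 - p).

(** The threshold 1 / 6 is the maximiser of [rate]; beyond it the dual parameter theta is negative,
    as [gbar5BP] requires. *)
Lemma opt_weight_gt1 p : 1 / 6 < p < 1 -> 1 < opt_weight p.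
Proof. by move=> /andP[p0 p1]; rewrite ltr_pdivlMr; lra. Qed.

Lemma rate_opt_weight p : 0 < p < 1 ->
  rate p = ln (1 + opt_weight p / 5) - p * ln (opt_weight p).
Proof.
move=> /andP[p0 p1]; have q0 : 0 < 1 - p by lra.
have -> : 1 + opt_weight p / 5 = (1 - p)^-1.
  by rewrite /opt_weight; field; rewrite gt_eqF.
by rewrite lnV ?posrE // ln_div ?posrE // /rate; lra.
Qed.

(** [rate] is a minimum over z of functions affine in p with slope [- ln z]; comparing at the
    optimal weight of p, which exceeds 1, avoids derivatives. *)
Lemma rate_decr p p' : 1 / 6 < p -> p < p' -> p' < 1 -> rate p' < rate p.
Proof.
move=> p0 pp' p1; have w1 : 1 < opt_weight p by apply: opt_weight_gt1; lra.
have : 0 < (p' - p) * ln (opt_weight p) by rewrite mulr_gt0 ?ln_gt0 ?subr_gt0.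
have := @rate_le p' (opt_weight p).
by rewrite (@rate_opt_weight p); lra.
Qed.

Lemma rate_continuous p : 0 < p < 1 -> {for p, continuous rate}.
Proof.
move=> /andP[p0 p1]; rewrite /rate.
apply: (@continuousB _ R^o _ (fun p : R => - (p * ln (5 * p))) (fun p : R => (1 - p) * ln (1 - p))).
  apply: continuousN; apply: continuousM; first exact: cvg_id.
  apply: (@continuous_comp _ _ _ (fun p : R => 5 * p) (@ln R)).
    by apply: continuousM; [exact: cvg_cst|exact: cvg_id].
  by apply: continuous_ln; lra.
have c1 : {for p, continuous (fun p : R => 1 - p)}.
  by apply: continuousB; [exact: cvg_cst|exact: cvg_id].
apply: continuousM => //.
apply: (@continuous_comp _ _ _ (fun p : R => 1 - p) (@ln R)) => //.
by apply: continuous_ln; lra.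
Qed.

(** Induction through (1 + 1 / n)^n <= e; this is the lower Stirling bound. *)
Lemma expr_le_fact_expR n : (0 < n)%N -> n%:R ^+ n <= n`!%:R * expR n%:R :> R.
Proof.
case: n => // n _; elim: n => [|n IH].
  by rewrite expr1 mul1r (le_trans _ (expR_ge1Dx _)) // lerDl.
have n0 : 0 < n.+1%:R :> R by rewrite ltr0n.
rewrite factS natrM -[in expR _]addn1 natrD expRD exprS.
have -> : n.+2%:R = n.+1%:R * (1 + n.+1%:R^-1) :> R.
  by rewrite mulrDr mulr1 divff ?gt_eqF // natr1.
rewrite exprMn.
have e1 : (1 + n.+1%:R^-1) ^+ n.+1 <= expR 1 :> R.
  have -> : expR 1 = expR n.+1%:R^-1 ^+ n.+1 :> R.
    by rewrite -expRM_natr mulVf ?gt_eqF.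
  rewrite lerXn2r ?nnegrE ?expR_ge0 ?expR_ge1Dx //.
have V0 : 0 <= 1 + n.+1%:R^-1 :> R by rewrite addr_ge0.
rewrite -[leRHS]mulrA; apply: ler_wpM2l; first by rewrite mulr_ge0.
by rewrite mulrA; apply: ler_pM => //; rewrite exprn_ge0.
Qed.

(** Induction through (1 - 1 / n)^n <= 1 / e; this is the upper Stirling bound, up to a factor of
    order sqrt n. *)
Lemma fact_expR_le n : (0 < n)%N ->
  n`!%:R * expR n%:R <= expR 1 * n%:R ^+ n.+1 :> R.
Proof.
case: n => // n _; elim: n => [|n IH]; first by rewrite mul1r expr1n mulr1.
have n0 : 0 < n.+1%:R :> R by rewrite ltr0n.
have n1 : 0 < n.+2%:R :> R by rewrite ltr0n.
rewrite factS natrM -[in expR _]addn1 natrD expRD.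
have e1 : expR 1 * n.+1%:R ^+ n.+2 <= n.+2%:R ^+ n.+2 :> R.
  have : (n.+1%:R / n.+2%:R) ^+ n.+2 <= expR (- 1) :> R.
    have -> : n.+1%:R / n.+2%:R = 1 - n.+2%:R^-1 :> R.
      by rewrite -[n.+2]addn1 natrD; field; rewrite gt_eqF.
    have -> : -1 = - n.+2%:R^-1 * n.+2%:R :> R by rewrite mulNr mulVf ?gt_eqF.
    rewrite expRM_natr lerXn2r ?nnegrE ?expR_ge0 ?expR_ge1Dx //.
    by rewrite subr_ge0 invf_le1 // ler1n.
  rewrite exprMn exprVn ler_pdivrMr ?exprn_gt0 // expRN mulrC ler_pdivlMr ?expR_gt0 //.
  by rewrite mulrC.
rewrite [in leRHS]exprS.
have := ler_wpM2r (expR_ge0 1) IH => H.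
have {}H : n.+1`!%:R * expR n.+1%:R * expR 1 <= expR 1 * n.+2%:R ^+ n.+2 :> R.
  by apply: le_trans H _; rewrite -mulrA (mulrC _ (expR 1)) ler_wpM2l ?expR_ge0.
by rewrite (mulrCA (expR 1)) -mulrA (ler_wpM2l (ltW n1)) // mulrA.
Qed.

(** The exponential equals n^n / (t^t s^s 5^t) with s = n - t; the Stirling bounds lose only e^2 t
    s, at most e^2 n^2. *)
Lemma bin_ge_expR_rate n t : (0 < t < n)%N ->
  expR (n%:R * rate (t%:R / n%:R)) / (expR 2 * n%:R ^+ 2) <=
  'C(n, t)%:R / 5 ^+ t.
Proof.
move=> /andP[t0 tn]; set s := (n - t)%N.
have s0 : (0 < s)%N by rewrite subn_gt0.
have ns : (n = t + s)%N by rewrite /s subnKC // ltnW.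
have T0 : 0 < t%:R :> R by rewrite ltr0n.
have S0 : 0 < s%:R :> R by rewrite ltr0n.
have N0 : 0 < n%:R :> R by rewrite ltr0n; lia.
have eN : n%:R = t%:R + s%:R :> R by rewrite ns natrD.
have -> : expR (n%:R * rate (t%:R / n%:R)) =
    n%:R ^+ n / (t%:R ^+ t * s%:R ^+ s * 5 ^+ t).
  have E x k : 0 < x -> x ^+ k = expR (k%:R * ln x) by move=> x0; rewrite expRM_natl lnK.
  rewrite !E // -!expRD -expRB; congr expR; rewrite /rate.
  have -> : 1 - t%:R / n%:R = s%:R / n%:R :> R by rewrite eN; field; rewrite -eN gt_eqF.
  rewrite mulrA !ln_div ?posrE ?mulr_gt0 // lnM ?posrE //.
  by rewrite eN; field; rewrite -eN gt_eqF.
have H1 := expr_le_fact_expR (ltn_trans t0 tn).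
have H2 := ler_pM (mulr_ge0 (ler0n _ _) (expR_ge0 _)) (mulr_ge0 (ler0n _ _) (expR_ge0 _))
  (fact_expR_le t0) (fact_expR_le s0).
have C0 : 0 <= 'C(n, t)%:R :> R by [].
have F : n`!%:R = 'C(n, t)%:R * (t`!%:R * s`!%:R) :> R by rewrite -!natrM bin_fact // ltnW.
rewrite -[_ / _ / _]mulrA -invfM ler_pdivrMr; last by rewrite !mulr_gt0 ?exprn_gt0 ?expR_gt0.
apply: le_trans H1 _; rewrite F.
have -> : expR n%:R = expR t%:R * expR s%:R :> R by rewrite eN expRD.
have -> : 'C(n, t)%:R * (t`!%:R * s`!%:R) * (expR t%:R * expR s%:R) =
  'C(n, t)%:R * (t`!%:R * expR t%:R * (s`!%:R * expR s%:R)) :> R by ring.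
apply: le_trans (ler_wpM2l C0 H2) _.
have -> : expR 2 = expR 1 * expR 1 :> R by rewrite -expRD; congr expR; lra.
rewrite -[leRHS]mulrA (ler_wpM2l C0) // !exprS.
have p5 : 0 < 5 ^+ t :> R by rewrite exprn_gt0.
have -> : (5 ^+ t)^-1 * (t%:R ^+ t * s%:R ^+ s * 5 ^+ t *
     (expR 1 * expR 1 * (n%:R * (n%:R * n%:R ^+ 0)))) =
   (expR 1 * expR 1 * t%:R ^+ t * s%:R ^+ s) * (n%:R * n%:R) :> R.
  by rewrite expr0; field; rewrite gt_eqF.
have -> : expR 1 * (t%:R * t%:R ^+ t) * (expR 1 * (s%:R * s%:R ^+ s)) =
   (expR 1 * expR 1 * t%:R ^+ t * s%:R ^+ s) * (t%:R * s%:R) :> R by ring.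
apply: ler_wpM2l; first by rewrite !mulr_ge0 ?expR_ge0 ?exprn_ge0.
by apply: ler_pM => //; rewrite eN ?lerDl ?lerDr.
Qed.

Lemma bin_unbounded n t (B : R) : (0 < t < n)%N -> 0 < rate (t%:R / n%:R) ->
  exists N, forall i, (N <= i)%N ->
    B < 'C(i * n, i * t)%:R / 5 ^+ (i * t).
Proof.
move=> tn r0; set r := rate _ in r0.
have N0 : 0 < n%:R :> R by rewrite ltr0n; lia.
(* [c * i] is the cubic Taylor term of the exponential divided by the polynomial loss at i n. *)
pose c := n%:R * r ^+ 3 / (6 * expR 2).
have c0 : 0 < c by rewrite divr_gt0 ?mulr_gt0 ?exprn_gt0 ?expR_gt0.
exists (Num.truncn (`|B| / c)).+1 => i Hi.
have i0 : 0 < i%:R :> R by rewrite ltr0n; lia.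
have tni : (0 < i * t < i * n)%N.
  by move: i0; rewrite ltr0n => i0'; rewrite muln_gt0 i0' ltn_pmul2l //; lia.
apply: lt_le_trans (bin_ge_expR_rate tni).
have -> : (i * t)%:R / (i * n)%:R = t%:R / n%:R :> R.
  by rewrite !natrM; field; rewrite !gt_eqF.
rewrite -/r; have := @expR_ge1Dxn _ ((i * n)%:R * r) 2 (mulr_ge0 (ler0n _ _) (ltW r0)) => E.
have Bi : B < c * i%:R.
  rewrite (le_lt_trans (ler_norm _)) // mulrC -ltr_pdivrMr //.
  apply: lt_le_trans (truncnS_gt _) _.
  by rewrite ler_nat.
apply: lt_le_trans Bi _; rewrite ler_pdivlMr; last by rewrite mulr_gt0 ?expR_gt0 ?exprn_gt0 ?ltr0n; lia.
apply: le_trans _ E; rewrite natrM /c.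
have -> : 3`!%:R = 6 :> R by [].
have -> : n%:R * r ^+ 3 / (6 * expR 2) * i%:R * (expR 2 * (i%:R * n%:R) ^+ 2) =
  (i%:R * n%:R * r) ^+ 3 / 6 :> R by field; rewrite gt_eqF // expR_gt0.
by rewrite lerDr.
Qed.

(** With z = 5^(- theta), theta <= 0 becomes z >= 1, and the objective of [gbar5BP] becomes minus
    the right-hand side of [rate_le]. *)
Lemma gbar_term p theta :
  (ln 2 - p * ln 5) * theta - ln (2 `^ theta + 1 / 5 * (2 / 5) `^ theta) =
  - (ln (1 + 5 `^ (- theta) / 5) - p * ln (5 `^ (- theta))) :> R.
Proof.
have h2 : 0 < 2 `^ theta :> R by rewrite powR_gt0.
have h5 : 0 < 5 `^ (- theta) :> R by rewrite powR_gt0.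
have -> : (2 / 5) `^ theta = 2 `^ theta * 5 `^ (- theta) :> R.
  rewrite powRM // ?invr_ge0 //; congr (_ * _).
  by rewrite -powR_inv1 // -powRrM mulN1r.
have -> : 2 `^ theta + 1 / 5 * (2 `^ theta * 5 `^ (- theta)) =
   2 `^ theta * (1 + 5 `^ (- theta) / 5) :> R by lra.
rewrite lnM ?posrE // ?addr_gt0 ?divr_gt0 // !ln_powR.
by lra.
Qed.

Lemma gbar5BP_root p : 1 / 6 < p < 1 -> rate p = 0 ->
  gbar5BP (ln 2 - p * ln 5) = 0%E.
Proof.
move=> p01 rp; have w1 := opt_weight_gt1 p01.
have p01' : 0 < p < 1 by lra.
have l5 : 0 < ln 5 :> R by rewrite ln_gt0; lra.
rewrite /gbar5BP; apply/eqP; rewrite oppe_eq0; apply/eqP/le_anti/andP; split.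
  apply: ge_ereal_sup => _ [theta _ <-]; rewrite lee_fin gbar_term oppr_le0.
  by rewrite -rp rate_le // powR_gt0.
apply: ereal_sup_ubound; exists (- (ln (opt_weight p) / ln 5)) => /=.
  by rewrite oppr_le0 ltW // divr_gt0 // ln_gt0.
rewrite gbar_term opprK.
have -> : 5 `^ (ln (opt_weight p) / ln 5) = opt_weight p.
  by rewrite /powR gt_eqF // divfK ?gt_eqF // lnK // posrE; lra.
by rewrite -rate_opt_weight // rp oppr0.
Qed.

(** Every b is [ln 2 - p' * ln 5] for some p'. If p' > p, the optimal weight of p makes the supremum
    positive; if p' < p, the supremum is negative. *)
Lemma gbar5BP_root_unique p b : 1 / 6 < p < 1 -> rate p = 0 ->
  gbar5BP b = 0%E -> b = ln 2 - p * ln 5.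
Proof.
move=> p01 rp gb; have w1 := opt_weight_gt1 p01.
have p01' : 0 < p < 1 by lra.
have l5 : 0 < ln 5 :> R by rewrite ln_gt0; lra.
pose p' := (ln 2 - b) / ln 5.
have eb : b = ln 2 - p' * ln 5 by rewrite /p' divfK ?gt_eqF //; lra.
rewrite eb in gb *; suff -> : p' = p by [].
have {gb} gb : ereal_sup [set ((ln 2 - p' * ln 5) * theta
     - ln (2 `^ theta + 1 / 5 * (2 / 5) `^ theta))%:E
               | theta in [set theta : R | (theta <= 0)%R]] = 0%E.
  by apply/eqP; rewrite -oppe_eq0; apply/eqP.
apply/eqP; rewrite eq_le; apply/andP; split; rewrite leNgt; apply/negP => lt.
  suff : (0 < ereal_sup [set ((ln 2 - p' * ln 5) * theta
     - ln (2 `^ theta + 1 / 5 * (2 / 5) `^ theta))%:E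
               | theta in [set theta : R | (theta <= 0)%R]])%E by rewrite gb ltxx.
  apply: (@lt_le_trans _ _ ((p' - p) * ln (opt_weight p))%:E).
    by rewrite lte_fin mulr_gt0 ?subr_gt0 ?ln_gt0.
  apply: ereal_sup_ubound; exists (- (ln (opt_weight p) / ln 5)) => /=.
    by rewrite oppr_le0 ltW // divr_gt0 // ln_gt0.
  rewrite gbar_term opprK.
  have -> : 5 `^ (ln (opt_weight p) / ln 5) = opt_weight p.
    by rewrite /powR gt_eqF // divfK ?gt_eqF // lnK // posrE; lra.
  by congr EFin; have := rate_opt_weight p01'; rewrite rp; lra.
(* A gap uniform in z >= 1 is required: [ln (1 + z / 5)] is at least [2 * c], which settles
   [ln z <= c]; otherwise the slope difference [p - p'] gives [(p - p') * c]. *)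
pose c : R := ln (6 / 5) / 2.
have c0 : 0 < c by rewrite /c divr_gt0 // ln_gt0; lra.
suff : (ereal_sup [set ((ln 2 - p' * ln 5) * theta
     - ln (2 `^ theta + 1 / 5 * (2 / 5) `^ theta))%:E
               | theta in [set theta : R | (theta <= 0)%R]] <= (- Num.min c ((p - p') * c))%:E)%E.
  rewrite gb lee_fin oppr_ge0; apply/negP; rewrite -ltNge lt_min c0 mulr_gt0 //.
  by rewrite subr_gt0.
apply: ge_ereal_sup => _ [theta /= th <-]; rewrite lee_fin gbar_term lerN2.
set z := 5 `^ (- theta).
have z0 : 0 < z by rewrite powR_gt0.
have z1 : 1 <= z by rewrite -(powRr0 5) ler_powR ?oppr_ge0 //; lra.
have lz0 : 0 <= ln z by rewrite ln_ge0.
have := rate_le p01' z0; rewrite rp => Hz.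
rewrite ge_min; have [lzc|lzc] := leP (ln z) c; apply/orP; [left|right].
  have : ln (6 / 5) <= ln (1 + z / 5) by rewrite ler_ln ?posrE; lra.
  have -> : ln (6 / 5) = 2 * c by rewrite /c; lra.
  have : p' * ln z <= p * ln z by rewrite ler_wpM2r // ltW.
  have : p * ln z <= 1 * ln z by rewrite ler_wpM2r //; lra.
  by lra.
have : (p - p') * c <= (p - p') * ln z by rewrite ler_wpM2l ?subr_ge0 // ltW.
by lra.
Qed.

End RateFunction.

(** * Rational enclosure of the root of the rate function *)

Section Numerics.
Variable R : realType.

Definition artanh_sum (n : nat) (t : R) : R :=
  \sum_(i < n) t ^+ (2 * i).+1 / (2 * i).+1%:R.

Lemma is_derive_artanh_sum n (t : R) :
  is_derive t 1 (artanh_sum n) (\sum_(i < n) t ^+ (2 * i)).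
Proof.
elim: n => [|n IH].
  rewrite big_ord0 (_ : artanh_sum 0 = cst 0); first exact: is_derive_cst.
  by apply/funext => x; rewrite /artanh_sum big_ord0.
have -> : artanh_sum n.+1 =
    (artanh_sum n : R -> R) + ((2 * n).+1%:R^-1 *: (@id R ^+ (2 * n).+1)).
  apply/funext => x; rewrite /artanh_sum big_ord_recr /=; congr (_ + _).
  by rewrite mulrC; congr (_ * _); rewrite exprfctE.
have dX := is_deriveX (2 * n).+1 (is_derive_id t (1 : R)).
apply: (is_derive_eq (is_deriveD IH (is_deriveZ (2 * n).+1%:R^-1 dX))).
rewrite big_ord_recr /=; congr (_ + _).
by rewrite -[LHS]/(_ * (_ * 1)) mulr1 mulKf // pnatr_eq0.
Qed.

Lemma is_derive_ln1D (x : R) : -1 < x ->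
  is_derive x 1 (fun y : R => ln (1 + y)) ((1 + x)^-1).
Proof.
move=> x1; have x0 : 0 < 1 + x by lra.
have := is_derive1_comp (is_derive1_ln x0) (is_deriveD (is_derive_cst (1 : R) x 1) (is_derive_id x 1)).
by rewrite add0r mulr1.
Qed.

Lemma is_derive_ln1B (x : R) : x < 1 ->
  is_derive x 1 (fun y : R => ln (1 - y)) (- (1 - x)^-1).
Proof.
move=> x1; have x0 : 0 < 1 - x by lra.
have := @is_derive1_comp R (@ln R) (fun y => 1 - y) x _ _ (is_derive1_ln x0) (is_deriveB (is_derive_cst (1 : R) x 1) (is_derive_id x 1)).
by rewrite sub0r mulrN1.
Qed.

(** The derivative of the difference is the geometric tail 2 x^(2n) / (1 - x^2), so the mean value
    theorem applies; for t <= 1 / 2, 2 / (1 - t^2) <= 8 / 3 < 3. *)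
Lemma ln_artanh_sum n (t : R) : 0 <= t <= 1 / 2 ->
  0 <= ln ((1 + t) / (1 - t)) - 2 * artanh_sum n t
    <= 3 * t ^+ (2 * n).+1.
Proof.
move=> /andP[t0 t1].
pose f (x : R) := ln (1 + x) - ln (1 - x) - 2 * artanh_sum n x.
pose df (x : R) := (1 + x)^-1 - - (1 - x)^-1 - 2 * \sum_(i < n) x ^+ (2 * i).
have D x : 0 <= x <= t -> is_derive x 1 f (df x).
  move=> /andP[x0 xt].
  have d1 : is_derive x 1 (fun y : R => ln (1 + y)) ((1 + x)^-1).
    by apply: is_derive_ln1D; lra.
  have d2 : is_derive x 1 (fun y : R => ln (1 - y)) (- (1 - x)^-1).
    by apply: is_derive_ln1B; lra.
  exact: is_deriveB (is_deriveB d1 d2) (is_deriveZ 2 (is_derive_artanh_sum n x)).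
have geo x : 0 <= x < 1 -> df x = 2 * x ^+ (2 * n) / (1 - x ^+ 2).
  move=> x01; have x2 : 1 - x ^+ 2 != 0 by apply/eqP; nra.
  have : (\sum_(i < n) x ^+ (2 * i)) * (1 - x ^+ 2) = 1 - x ^+ (2 * n).
    elim: (n) => [|m IH]; first by rewrite big_ord0 mul0r muln0 expr0 subrr.
    by rewrite big_ord_recr /= mulrDl IH mulnS exprD; ring.
  move/(canRL (mulfK x2)) => E; rewrite /df E.
  by field; rewrite x2 !gt_eqF //; lra.
have [||c] := @MVT_segment R f df 0 t t0.
- by move=> x /[!in_itv] /= /andP[x0 xt]; apply: D; rewrite !ltW.
- apply: derivable_within_continuous => x /[!in_itv] /= xt.
  by have [] := D x xt.
rewrite in_itv /= => /andP[c0 ct].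
have -> : f 0 = 0.
  rewrite /f /artanh_sum big1 ?addr0 ?subr0 ?subrr ?mulr0 ?subr0 //.
  by move=> i _; rewrite expr0n mul0r.
rewrite !subr0 geo => [E|]; last by lra.
rewrite ln_div ?posrE; try lra.
rewrite -[_ - _ - _]/(f t) E [t ^+ _.+1]exprSr mulrA.
have c2 : c ^+ 2 <= t ^+ 2 by rewrite lerXn2r.
have t2 : 0 < 1 - t ^+ 2 by nra.
have cn : c ^+ (2 * n) <= t ^+ (2 * n) by rewrite lerXn2r.
have cn0 : 0 <= c ^+ (2 * n) by rewrite exprn_ge0.
apply/andP; split.
  by rewrite mulr_ge0 // divr_ge0 ?mulr_ge0 //; lra.
apply: ler_wpM2r => //; rewrite ler_pdivrMr; last by lra.
have : t ^+ (2 * n) * c ^+ 2 <= t ^+ (2 * n) * (1 / 4).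
  by rewrite ler_wpM2l ?exprn_ge0 //; nra.
by lra.
Qed.

Ltac eval_artanh_sum :=
  rewrite /artanh_sum !big_ord_recr !big_ord0 /=;
  repeat match goal with |- context [((2 * ?k).+1)%N] =>
    let v := eval vm_compute in ((2 * k).+1)%N in change ((2 * k).+1)%N with v
  end.

Lemma ln2_bounds : 693 / 10 ^+ 3 + 147 / 10 ^+ 6 + 180 / 10 ^+ 9 <= ln (2 : R)
  <= 693 / 10 ^+ 3 + 147 / 10 ^+ 6 + 181 / 10 ^+ 9.
Proof.
have [] := andP (@ln_artanh_sum 10 (1 / 3) _); first by lra.
have -> : (1 + 1 / 3) / (1 - 1 / 3) = 2 :> R by field.
by eval_artanh_sum; lra.
Qed.

Lemma ln54_bounds : 223 / 10 ^+ 3 + 143 / 10 ^+ 6 + 551 / 10 ^+ 9 <= ln (5 / 4 : R)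
  <= 223 / 10 ^+ 3 + 143 / 10 ^+ 6 + 552 / 10 ^+ 9.
Proof.
have [] := andP (@ln_artanh_sum 5 (1 / 9) _); first by lra.
have -> : (1 + 1 / 9) / (1 - 1 / 9) = 5 / 4 :> R by field.
by eval_artanh_sum; lra.
Qed.

Lemma ln5E : ln 5 = 2 * ln 2 + ln (5 / 4) :> R.
Proof.
transitivity (ln (2 * 2 * (5 / 4)) : R); first by congr ln; lra.
by rewrite !lnM ?posrE //; lra.
Qed.

(** For p near 0.42 both 5 p / 2 and 2 (1 - p) are close to 1, where the series converges fast. *)
Let rateE (p : R) : 0 < p < 1 ->
  rate p = (1 - 2 * p) * ln 2 - p * ln (5 * p / 2) - (1 - p) * ln (2 * (1 - p)).
Proof.
move=> p01; rewrite /rate ln_div ?posrE; try lra.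
by rewrite [ln (2 * _)]lnM ?posrE; lra.
Qed.

(* Numerals of [ring_scope] are unary, whence the groups of three digits. The
   root of [rate] is 0.42334594956..., and below t and u are one-sided roundings of
   (x - 1) / (x + 1) for x = 5 * p / 2 and for x = 2 * (1 - p). *)
Definition p_lo : R := 423 / 10 ^+ 3 + 345 / 10 ^+ 6 + 948 / 10 ^+ 9.
Definition p_hi : R := 423 / 10 ^+ 3 + 345 / 10 ^+ 6 + 951 / 10 ^+ 9.

Lemma rate_p_lo_gt0 : 0 < rate p_lo.
Proof.
rewrite rateE; last by rewrite /p_lo; lra.
pose t : R := 28 / 10 ^+ 3 + 354 / 10 ^+ 6 + 967 / 10 ^+ 9 + 990 / 10 ^+ 12.
pose u : R := 71 / 10 ^+ 3 + 196 / 10 ^+ 6 + 548 / 10 ^+ 9 + 100 / 10 ^+ 12.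
have Lt : ln (5 * p_lo / 2) <= ln ((1 + t) / (1 - t)).
  by rewrite ler_ln ?posrE ?ler_pdivlMr ?divr_gt0 // /t /p_lo; lra.
have Lu : ln (2 * (1 - p_lo)) <= ln ((1 + u) / (1 - u)).
  by rewrite ler_ln ?posrE ?ler_pdivlMr ?divr_gt0 // /u /p_lo; lra.
have /andP[_] : _ <= _ <= _ := @ln_artanh_sum 3 t ltac:(rewrite /t; lra).
have /andP[_] : _ <= _ <= _ := @ln_artanh_sum 4 u ltac:(rewrite /u; lra).
have := ln2_bounds; move: (ln _) (ln _) (ln _) (ln _) (ln _) Lt Lu => l1 l2 l3 l4 l5.
by eval_artanh_sum; rewrite /t /u /p_lo; lra.
Qed.

Lemma rate_p_hi_lt0 : rate p_hi < 0.
Proof.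
rewrite rateE; last by rewrite /p_hi; lra.
pose t : R := 28 / 10 ^+ 3 + 354 / 10 ^+ 6 + 971 / 10 ^+ 9 + 530 / 10 ^+ 12.
pose u : R := 71 / 10 ^+ 3 + 196 / 10 ^+ 6 + 545 / 10 ^+ 9 + 511 / 10 ^+ 12.
have Lt : ln ((1 + t) / (1 - t)) <= ln (5 * p_hi / 2).
  by rewrite ler_ln ?posrE ?ler_pdivrMr ?divr_gt0 // /t /p_hi; lra.
have Lu : ln ((1 + u) / (1 - u)) <= ln (2 * (1 - p_hi)).
  by rewrite ler_ln ?posrE ?ler_pdivrMr ?divr_gt0 // /u /p_hi; lra.
have /andP[+ _] : _ <= _ <= _ := @ln_artanh_sum 3 t ltac:(rewrite /t; lra).
have /andP[+ _] : _ <= _ <= _ := @ln_artanh_sum 4 u ltac:(rewrite /u; lra).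
have := ln2_bounds; move: (ln _) (ln _) (ln _) (ln _) (ln _) Lt Lu => l1 l2 l3 l4 l5.
by eval_artanh_sum; rewrite /t /u /p_hi; lra.
Qed.

Lemma rate_root : exists2 p : R, p_lo <= p <= p_hi & rate p = 0.
Proof.
have [|||p] := @IVT R (@rate R) p_lo p_hi 0; first by rewrite /p_lo /p_hi; lra.
- apply: continuous_in_subspaceT => x; rewrite inE /= in_itv /= => x01.
  by apply: rate_continuous; move: x01; rewrite /p_lo /p_hi; lra.
- have := rate_p_lo_gt0; have := rate_p_hi_lt0 => rn rp.
  by rewrite ge_min le_max (ltW rn) (ltW rp) orbT.
by rewrite in_itv /= => H E; exists p.
Qed.

Lemma root_approx (p : R) : p_lo <= p <= p_hi ->
  `|ln 2 - p * ln 5 - (1179 / 10 ^+ 5 + 816 / 10 ^+ 8)| < 5 / 10 ^+ 9.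
Proof.
move=> /andP[p1 p2]; have := ln2_bounds; have := ln54_bounds => h54 h2.
have l5 : 0 <= ln 5 :> R by rewrite ln_ge0 //; lra.
have := ler_wpM2r l5 p1; have := ler_wpM2r l5 p2; rewrite ln5E => H1 H2.
by move: H1 H2; rewrite ltr_norml /p_lo /p_hi => H1 H2; apply/andP; split; lra.
Qed.

End Numerics.

(** * Averages over finitely many digits *)

Section DigitAverage.
Variable R : realType.
Implicit Types (dig : seq bool -> 'I_5) (s : seq (seq bool)) (b : bool).

Definition set_digit dig u c : seq bool -> 'I_5 :=
  fun v => if v == u then c else dig v.

(** Words are read from right to left: [rcons v b] is the descendant v of the child [[:: b]] of the
    root. *)
Definition subtree b dig : seq bool -> 'I_5 := fun v => dig (rcons v b).

Fixpoint avg s (Q : (seq bool -> 'I_5) -> R) dig : R :=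
  match s with
  | [::] => Q dig
  | u :: s' => 5^-1 * \sum_(c < 5) avg s' Q (set_digit dig u c)
  end.

Lemma avg_cat s1 s2 Q dig : avg (s1 ++ s2) Q dig = avg s1 (avg s2 Q) dig.
Proof. by elim: s1 dig => //= u s1 IH dig; under eq_bigr do rewrite IH. Qed.

Lemma eq_avg s Q Q' dig :
  (forall d, (forall v, v \notin s -> d v = dig v) -> Q d = Q' d) ->
  avg s Q dig = avg s Q' dig.
Proof.
elim: s dig => [|u s IH] dig H /=; first exact: H.
congr (_ * _); apply: eq_bigr => c _; apply: IH => d Hd; apply: H => v.
by rewrite in_cons negb_or => /andP[vu vs]; rewrite Hd // /set_digit (negbTE vu).
Qed.

Lemma subtree_set_digit b dig u c :
  subtree b (set_digit dig (rcons u b) c) = set_digit (subtree b dig) u c.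
Proof. by apply/funext => v; rewrite /subtree /set_digit eqseq_rcons eqxx andbT. Qed.

Lemma subtreeN_set_digit b dig u c :
  subtree (~~ b) (set_digit dig (rcons u b) c) = subtree (~~ b) dig.
Proof.
by apply/funext => v; rewrite /subtree /set_digit eqseq_rcons; case: b; rewrite andbF.
Qed.

(** Independence of the two subtrees of the root: changing digits in one leaves the other
    unchanged. *)
Lemma avg_subtree b s (F G : (seq bool -> 'I_5) -> R) dig :
  avg [seq rcons u b | u <- s] (fun d => F (subtree b d) * G (subtree (~~ b) d)) dig
  = avg s F (subtree b dig) * G (subtree (~~ b) dig).
Proof.
elim: s dig => //= u s IH dig.
under eq_bigr do rewrite IH subtree_set_digit subtreeN_set_digit.
by rewrite -mulr_suml mulrA.
Qed.

(* The individuals that may have children in generations 1, ..., k. *)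
Fixpoint words (k : nat) : seq (seq bool) :=
  if k is k'.+1 then [::] :: [seq rcons u false | u <- words k'] ++
    [seq rcons u true | u <- words k'] else [::].

Lemma nil_notin_map_rcons b s : [::] \notin [seq rcons u b | u <- s].
Proof. by apply/mapP => -[[|? ?] _]. Qed.

Lemma uniq_words k : uniq (words k).
Proof.
elim: k => //= k IH; rewrite mem_cat negb_or !nil_notin_map_rcons /=.
rewrite cat_uniq !map_inj_uniq ?IH /=; try by move=> u v /rcons_inj[].
by rewrite andbT; apply/hasPn => _ /mapP[u _ ->]; apply/mapP => -[v _ /rcons_inj[]].
Qed.

Fixpoint hit (j k a m : nat) dig : bool :=
  if k is k'.+1 then
    let n := lift5 j a (dig [::]) in
    hit j k' (type_fst j n) m (subtree false dig) ||
    (has_snd n && hit j k' (type_snd j n) m.-1 (subtree true dig))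
  else (m == 0)%N.

Lemma eq_hit j k a m dig dig' : {in words k, dig =1 dig'} ->
  hit j k a m dig = hit j k a m dig'.
Proof.
elim: k a m dig dig' => //= k IH a m dig dig' H.
rewrite (H [::]) ?in_cons ?eqxx //.
by congr (_ || (_ && _)); apply: IH => u uk; apply: H; rewrite in_cons mem_cat;
  apply/orP; right; apply/orP; [left|right]; exact: map_f.
Qed.

(** Once the root digit is fixed, the two subtrees are independent, which reproduces the recursion
    of [miss]. *)
Lemma avg_miss j k a m dig :
  avg (words k) (fun d => (~~ hit j k a m d)%:R) dig = miss R j k a m.
Proof.
elim: k a m dig => [|k IH] a m dig; first by rewrite /= lt0n.
rewrite missSE /=; congr (_ * _); apply: eq_bigr => c _.
set n := lift5 j a c.
pose F d : R := (~~ hit j k (type_fst j n) m d)%:R.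
pose G d : R := if has_snd n then (~~ hit j k (type_snd j n) m.-1 d)%:R else 1.
transitivity (avg ([seq rcons u false | u <- words k] ++ [seq rcons u true | u <- words k])
    (fun d => G (subtree true d) * F (subtree (~~ true) d)) (set_digit dig [::] c)).
  apply: eq_avg => d Hd; have -> : d [::] = c.
    by rewrite Hd ?mem_cat ?negb_or ?nil_notin_map_rcons // /set_digit eqxx.
  rewrite -/n /F /G /= negb_or mulrC; case: (has_snd n) => /=; last by rewrite andbT mulr1.
  by case: (hit _ _ _ _ _) => /=; rewrite ?mul0r ?mul1r.
rewrite avg_cat; transitivity (avg [seq rcons u false | u <- words k]
    (fun d => F (subtree false d) * avg (words k) G (subtree (~~ false) d))
    (set_digit dig [::] c)).
  by apply: eq_avg => d _; rewrite (avg_subtree true (words k) G F) mulrC.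
rewrite (avg_subtree false (words k) F (fun d => avg (words k) G d)) IH; congr (_ * _).
rewrite /G; case: (has_snd n); first exact: IH.
by elim: (words k) (subtree _ _) => //= u s IHs d; under eq_bigr do rewrite IHs; rewrite avg5_const.
Qed.

End DigitAverage.

(** * Probabilities of events depending on finitely many digits *)

Section DigitProbability.
Context (R : realType) (d : measure_display) (T : measurableType d).
Variables (P : probability T R) (D : seq bool -> T -> 'I_5).
Hypothesis iidD : iid_uniform_digits P D.

Definition cylinder (t : seq (seq bool)) (dig : seq bool -> 'I_5) : set T :=
  \bigcap_(u in [set` t]) (D u @^-1` [set dig u]).

Lemma measurable_cylinder t dig : measurable (cylinder t dig).
Proof.
case: iidD => mD _ _; apply: fin_bigcap_measurable => // u _; exact: mD.
Qed.

Lemma probability_cylinder t dig : uniq t ->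
  P (cylinder t dig) = ((5^-1) ^+ size t)%:E.
Proof.
case: iidD => _ uD indD ut; rewrite /cylinder (indD t (fun u => [set dig u])) //.
under eq_bigr do rewrite uD.
by elim: t {ut} => [|u t IH]; rewrite ?big_nil // big_cons IH /= -EFinM div1r -exprS.
Qed.

(* Induction on the digits s still to be revealed, those of t being known. *)
Lemma cylinder_event_avg s t (Q : (seq bool -> 'I_5) -> bool) dig :
  uniq (s ++ t) ->
  (forall d1 d2, {in s ++ t, d1 =1 d2} -> Q d1 = Q d2) ->
  measurable (cylinder t dig `&` [set w | Q (D ^~ w)]) /\
  P (cylinder t dig `&` [set w | Q (D ^~ w)]) =
    ((5^-1) ^+ size t * avg s (fun d' => (Q d')%:R) dig)%:E.
Proof.
elim: s t dig => [|u s IH] t dig /= us HQ.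
  have Qw w : cylinder t dig w -> Q (D ^~ w) = Q dig.
    by move=> cw; apply: HQ => v vt; exact: cw.
  have [Qd|Qd] := boolP (Q dig).
    have -> : cylinder t dig `&` [set w | Q (D ^~ w)] = cylinder t dig.
      by apply/setIidl => w /Qw /= ->.
    by rewrite mulr1 probability_cylinder //; split => //; exact: measurable_cylinder.
  have -> : cylinder t dig `&` [set w | Q (D ^~ w)] = set0.
    by apply/seteqP; split => // w [/Qw /= ->]; rewrite (negbTE Qd).
  by rewrite mulr0 measure0.
have {}IH c := IH (u :: t) (set_digit dig u c).
have perm : perm_eq (s ++ u :: t) (u :: s ++ t) by rewrite -[u :: t]cat1s perm_catCA.
have us' : uniq (s ++ u :: t) by rewrite (perm_uniq perm).
have HQ' d1 d2 : {in s ++ u :: t, d1 =1 d2} -> Q d1 = Q d2.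
  by move=> H; apply: HQ => v; rewrite -(perm_mem perm) => /H.
have ut : u \notin t.
  by move: us => /andP[]; rewrite mem_cat negb_or => /andP[].
pose A c := cylinder (u :: t) (set_digit dig u c) `&` [set w | Q (D ^~ w)].
have mA c : measurable (A c) by case: (IH c us' HQ').
have AE : cylinder t dig `&` [set w | Q (D ^~ w)] = \big[setU/set0]_(c < 5) A c.
  apply/seteqP; split => [w [cw Qw]|w].
    rewrite -bigcup_seq; exists (D u w) => /=; first by rewrite mem_index_enum.
    split=> // v /=; rewrite in_cons /set_digit => /orP[/eqP->|vt]; first by rewrite eqxx.
    by rewrite ifN; [exact: cw|apply: contraNneq ut => <-].
  rewrite -bigcup_seq => -[c _ [cw Qw]]; split=> // v /= vt.
  have := cw v; rewrite /= in_cons vt orbT => /(_ isT); rewrite /set_digit ifN //.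
  by apply: contraNneq ut => <-.
have tA : trivIset setT A.
  apply/trivIsetP => c1 c2 _ _ c12; apply/seteqP; split => // w [[c1w _] [c2w _]].
  move: (c1w u) (c2w u); rewrite /= in_cons eqxx /set_digit eqxx => /(_ isT) E1 /(_ isT) E2.
  by move: c12; rewrite -E1 -E2 eqxx.
rewrite AE; split; first exact: bigsetU_measurable.
rewrite measure_bigsetU_ord //.
have PA c : P (A c) = _ := proj2 (IH c us' HQ').
rewrite (eq_bigr _ (fun c _ => PA c)) /=.
by rewrite sumEFin -mulr_sumr exprS; congr EFin; ring.
Qed.

Lemma measurable_hit j k a m : measurable [set w | hit j k a m (D ^~ w)].
Proof.
have us : uniq (words k ++ [::]) by rewrite cats0 uniq_words.
have HQ (d1 d2 : seq bool -> 'I_5) : {in words k ++ [::], d1 =1 d2} ->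
    hit j k a m d1 = hit j k a m d2 by rewrite cats0; exact: eq_hit.
have [] := cylinder_event_avg (fun=> ord0) us HQ.
by rewrite /cylinder /= set_nil bigcap_set0 setTI.
Qed.

Lemma probability_miss j k a m :
  P (~` [set w | hit j k a m (D ^~ w)]) = (miss R j k a m)%:E.
Proof.
have us : uniq (words k ++ [::]) by rewrite cats0 uniq_words.
have HQ (d1 d2 : seq bool -> 'I_5) : {in words k ++ [::], d1 =1 d2} ->
    ~~ hit j k a m d1 = ~~ hit j k a m d2 by rewrite cats0 => H; rewrite (eq_hit _ _ _ H).
have [_] := cylinder_event_avg (fun=> ord0) us HQ.
rewrite /cylinder /= set_nil bigcap_set0 setTI avg_miss mul1r => <-.
by congr (P _); apply/seteqP; split => w /= /negP.
Qed.

Lemma probability_hit j k a m :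
  P [set w | hit j k a m (D ^~ w)] = (1 - miss R j k a m)%:E.
Proof.
rewrite -[X in P X]setCK probability_setC; last exact: measurableC (measurable_hit _ _ _ _).
by rewrite probability_miss.
Qed.

(** First Borel-Cantelli lemma: the exceptional null set is the limsup of a summable sequence of
    events. *)
Lemma ae_eventually_not (A : nat -> set T) (C rho : R) :
  (forall n, measurable (A n)) -> 0 <= C -> 0 <= rho < 1 ->
  (forall n, (P (A n) <= (C * rho ^+ n)%:E)%E) ->
  {ae P, forall w, exists N, forall n, (N <= n)%N -> ~ A n w}.
Proof.
move=> mA C0 /andP[r0 r1] PA; exists (lim_sup_set A); split.
- apply: bigcap_measurable => // n _; apply: bigcup_measurable => k _; exact: mA.
- apply: lim_sup_set_cvg0 => //.
  apply: (@le_lt_trans _ _ (C / (1 - rho))%:E); last exact: ltry.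
  apply: lime_le; first by apply: is_cvg_nneseries => n _ _; exact: measure_ge0.
  apply: nearW => n /=.
  apply: (@le_trans _ _ (\sum_(0 <= i < n) (C * rho ^+ i)%:E)%E).
    by apply: lee_sum => i _; exact: PA.
  have r1' : 0 < 1 - rho by lra.
  rewrite sumEFin lee_fin ler_pdivlMr //.
  have -> : (\sum_(0 <= i < n) C * rho ^+ i) * (1 - rho) = C * (1 - rho ^+ n).
    elim: n => [|n IHn]; first by rewrite big_nil expr0 subrr mulr0 mul0r.
    by rewrite big_nat_recr //= mulrDl IHn exprS; ring.
  by rewrite ler_piMr // lerBlDr lerDl exprn_ge0.
move=> w /= H n _; apply: contrapT => H'; apply: H; exists n => k nk Ak; apply: H'.
by exists k.
Qed.

End DigitProbability.

(** * Leftmost position in terms of counts of second children *)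

Section Genealogy.
Variables (R : realType) (j : nat).
Implicit Types (dig : seq bool -> 'I_5) (u : seq bool) (x y : R).

(** The root type is arbitrary because unfolding the first generation moves the root to one of its
    children. *)
Fixpoint individual_from (a0 : nat) x0 dig u : option (nat * R) :=
  match u with
  | [::] => Some (a0, x0)
  | b :: v =>
    match individual_from a0 x0 dig v with
    | None => None
    | Some (a, y) =>
      let at5 := lift5 j a (dig v) in
      if b then
        if has_snd at5 then Some (type_snd j at5, y + ln (2 / 5)) else None
      else Some (type_fst j at5, y + ln 2)
    end
  end.

Lemma individualE x0 dig u : individual j x0 dig u = individual_from 1 x0 dig u.
Proof. by elim: u => //= b u ->. Qed.

(** [individual_from] recurses on the last generation and [hit] on the first; this converts between
    the two. *)
Lemma individual_from_rcons a x0 dig u b :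
  individual_from a x0 dig (rcons u b) =
  let n := lift5 j a (dig [::]) in
  if b then
    if has_snd n
    then individual_from (type_snd j n) (x0 + ln (2 / 5)) (subtree true dig) u
    else None
  else individual_from (type_fst j n) (x0 + ln 2) (subtree false dig) u.
Proof.
elim: u => [|c u IH] /=; first by case: b.
rewrite IH /=; case: b {IH} => //.
by case: ifP.
Qed.

Lemma individual_from_position a x0 dig u b y :
  individual_from a x0 dig u = Some (b, y) ->
  y = x0 + (size u)%:R * ln 2 - (count id u)%:R * ln 5.
Proof.
have l25 : ln (2 / 5) = ln 2 - ln 5 :> R by rewrite ln_div ?posrE.
elim: u b y => [|c u IH] b y /=; first by case=> _ <-; rewrite !mul0r addr0 subr0.
case: (individual_from _ _ _ u) IH => [[b' y']|] // /(_ _ _ erefl) ->.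
have -> : (size u).+1%:R = (size u)%:R + 1 :> R by rewrite natr1.
case: c => /=; last by case=> _ <-; rewrite add0n; lra.
case: ifP => // _ [_ <-]; rewrite l25 add1n.
have -> : (count id u).+1%:R = (count id u)%:R + 1 :> R by rewrite natr1.
by lra.
Qed.

Lemma hitP k a m x0 dig :
  reflect (exists u b y, [/\ size u = k, individual_from a x0 dig u = Some (b, y)
             & (m <= count id u)%N])
    (hit j k a m dig).
Proof.
apply: (iffP idP).
  elim: k a m x0 dig => [|k IH] a m x0 dig /=.
    by move=> /eqP ->; exists [::], a, x0.
  case/orP => [/IH|/andP[hs /IH]] H.
    have [u [b [y [su iu mu]]]] := H (x0 + ln 2).
    exists (rcons u false), b, y; rewrite size_rcons su individual_from_rcons /= iu.
    by split=> //; rewrite -cats1 count_cat addn0.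
  have [u [b [y [su iu mu]]]] := H (x0 + ln (2 / 5)).
  exists (rcons u true), b, y; rewrite size_rcons su individual_from_rcons /= hs iu.
  by split=> //; rewrite -cats1 count_cat /=; lia.
elim: k a m x0 dig => [|k IH] a m x0 dig [u [b [y [su iu mu]]]].
  by move: mu; rewrite (size0nil su) leqn0.
case/lastP: u su iu mu => // u c; rewrite size_rcons => -[su].
rewrite individual_from_rcons -cats1 count_cat /=; case: c.
  case: ifP => // hs iu mu; apply/orP; right; apply: (IH _ _ (x0 + ln (2 / 5))).
  by exists u, b, y; split=> //; move: mu => /=; lia.
move=> iu mu; apply/orP; left; apply: (IH _ _ (x0 + ln 2)).
by exists u, b, y; split=> //; move: mu => /=; lia.
Qed.

Lemma hitS k a m dig : hit j k a m dig -> hit j k.+1 a m dig.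
Proof.
elim: k a m dig => [|k IH] a m dig; first by rewrite /= => ->.
move=> /orP[/IH H|/andP[hs /IH H]]; apply/orP; [by left|right].
by rewrite hs.
Qed.

Lemma hit_leq k k' a m dig : (k <= k')%N -> hit j k a m dig -> hit j k' a m dig.
Proof.
by move=> /subnK <- H; elim: (k' - k)%N => // i; rewrite addSn; exact: hitS.
Qed.

Lemma leftmost_le_hit x0 dig k m : hit j k 1 m dig ->
  leftmost j x0 dig k <= x0 + k%:R * ln 2 - m%:R * ln 5.
Proof.
move=> /(@hitP _ _ _ x0)[u [b [y [su iu mu]]]].
have [_ H] := leftmost_min j x0 dig k.
apply: (@le_trans _ _ y).
  by apply: H; exists u, b; rewrite individualE.
have l5 : 0 <= ln 5 :> R by rewrite ln_ge0 //; lra.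
rewrite (individual_from_position iu) su lerD2l lerN2 ler_wpM2r //.
by rewrite ler_nat.
Qed.

Lemma leftmost_ge_miss x0 dig k m : ~~ hit j k 1 m dig ->
  x0 + k%:R * ln 2 - m%:R * ln 5 <= leftmost j x0 dig k.
Proof.
move=> nh; have [[u [b [su iu]]] _] := leftmost_min j x0 dig k.
rewrite individualE in iu.
have l5 : 0 <= ln 5 :> R by rewrite ln_ge0 //; lra.
rewrite (individual_from_position iu) su lerD2l lerN2 ler_wpM2r //.
rewrite ler_nat leqNgt; apply: contra nh => mu.
by apply/(@hitP _ _ _ x0); exists u, b, (leftmost j x0 dig k); split=> //; exact: ltnW.
Qed.

End Genealogy.

(** Compares generation k with an earlier one of the form n A + q, at most A generations back. *)
Lemma divn_sub_bounds N A q k : (0 < A)%N -> (N * A + q <= k)%N ->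
  [/\ N <= (k - q) %/ A, (k - q) %/ A * A + q <= k &
      k <= (k - q) %/ A * A + q + A]%N.
Proof.
move=> A0 H; have qk : (q <= k)%N := leq_trans (leq_addl _ _) H.
move: H; rewrite -(subnK qk); move: (k - q)%N => m.
rewrite leq_add2r !addnK leq_divRL // => ->; split=> //.
  by rewrite leq_add2r leq_divM.
by rewrite addnAC leq_add2r addnC -mulSn ltnW // ltn_ceil.
Qed.

(** * Almost sure bounds and the limit *)

Section AlmostSure.
Context (R : realType) (d : measure_display) (T : measurableType d).
Variables (P : probability T R) (D : seq bool -> T -> 'I_5) (j : nat) (x0 : R).
Hypotheses (j_gt0 : (0 < j)%N) (iidD : iid_uniform_digits P D).

(** The Chernoff bound at the optimal weight is exp(k rate(p)) up to a constant, hence summable;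
    passing from all root types to type 1 costs only the number of types. *)
Lemma ae_eventually_miss (p : R) : 1 / 6 < p < 1 -> rate p < 0 ->
  {ae P, forall w, exists N, forall k, (N <= k)%N ->
    ~ hit j k 1 (Num.truncn (p * k%:R)).+1 (D ^~ w)}.
Proof.
move=> p01 rp; have z1 := opt_weight_gt1 p01.
set z := opt_weight p in z1.
have p01' : 0 < p < 1 by lra.
apply: (@ae_eventually_not _ _ _ P
  (fun k => [set w | hit j k 1 (Num.truncn (p * k%:R)).+1 (D ^~ w)])
  (size (types j))%:R (expR (rate p))) => //.
- by move=> n; exact: (measurable_hit iidD).
- by rewrite expR_ge0 expR_lt1.
move=> k; rewrite probability_hit // lee_fin; set m := (Num.truncn _).+1.
have zm : 0 < z ^+ m by rewrite exprn_gt0 //; lra.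
apply: (@le_trans _ _ ((size (types j))%:R * (1 + z / 5) ^+ k / z ^+ m)).
  rewrite ler_pdivlMr //; apply: le_trans _ (sum_types_hit j_gt0 k m (ltW z1)).
  apply: ler_wpM2r; first exact: ltW.
  rewrite (bigD1_seq 1%N) ?one_in_types ?uniq_types //= lerDl sumr_ge0 // => a _.
  by rewrite subr_ge0 miss_le1.
rewrite -mulrA ler_wpM2l // ler_pdivrMr //.
have E (x : R) n : 0 < x -> x ^+ n = expR (n%:R * ln x).
  by move=> ?; rewrite expRM_natl lnK.
rewrite -expRM_natl (E (1 + z / 5)) ?(E z); try lra.
rewrite -expRD ler_expR (rate_opt_weight p01') -/z.
have : p * k%:R * ln z <= m%:R * ln z.
  apply: ler_wpM2r; first by rewrite ln_ge0 // ltW.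
  exact: ltW (truncnS_gt _).
by lra.
Qed.

(** A rational t / n strictly between p' and p has positive rate. Scaling it by a large i makes some
    mean exceed 1 and the fewer than 2 q extra generations affordable. *)
Lemma miss_supercritical (p p' : R) : 1 / 6 < p' < p -> p < 1 -> rate p = 0 ->
  exists A r rho, [/\ (0 < A)%N, p' * A%:R <= r%:R, 0 <= rho < 1 &
    forall n, miss R j (n * A + 4 * 5 ^ j.-1) 1 (n * r) <= rho ^+ n].
Proof.
move=> /andP[p'6 p'p] p1 rp; set q := (4 * 5 ^ j.-1)%N.
pose e := (p - p') / 2; have e0 : 0 < e by rewrite /e; lra.
(* As n exceeds 1 / e, rounding (p - e) n down still leaves t / n above p'. *)
pose n := (Num.truncn (e^-1)).+1; pose t := Num.truncn ((p - e) * n%:R).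
have n0 : 0 < n%:R :> R by rewrite ltr0n.
have ne : 1 < e * n%:R by rewrite mulrC -ltr_pdivrMr // div1r truncnS_gt.
have pe0 : 0 <= (p - e) * n%:R by rewrite mulr_ge0 // /e; lra.
have /andP[t1 t2] := truncn_itv pe0; rewrite -/t in t1 t2.
have t2' : (p - e) * n%:R < t%:R + 1 by rewrite natr1.
have p't : p' * n%:R < t%:R by move: ne t2'; rewrite /e; lra.
have tn : (0 < t < n)%N.
  rewrite -(ltr0n R) -(ltr_nat R); apply/andP; split.
    by apply: le_lt_trans p't; rewrite mulr_ge0 //; lra.
  by apply: le_lt_trans t1 _; rewrite gtr_pMl // /e; lra.
have tnp : p' < t%:R / n%:R < p.
  rewrite ltr_pdivlMr // p't /= ltr_pdivrMr //; apply: le_lt_trans t1 _.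
  by rewrite ltr_pM2r //; lra.
have rtn : 0 < rate (t%:R / n%:R : R).
  by rewrite -rp; apply: rate_decr => //; lra.
have [N HN] := bin_unbounded (size (types j))%:R tn rtn.
pose g : R := t%:R - p' * n%:R; have g0 : 0 < g by rewrite subr_gt0.
(* The surplus g, earned i times, pays for 2 q generations at ratio p'. *)
pose i := maxn N (Num.truncn (2 * q%:R * p' / g)).+1.
have ig : 2 * q%:R * p' <= i%:R * g.
  rewrite -ler_pdivrMr //; apply: le_trans (ltW (truncnS_gt _)) _.
  by rewrite ler_nat leq_maxr.
have [i0 li0 m1] := mean_ones_large j_gt0 (HN i (leq_maxl _ _)).
have [rho rho01 Hrho] := miss_decay j_gt0 m1.
exists (i0 + i * n + q)%N, (i * t)%N, rho; split=> //.
  by rewrite addn_gt0 muln_gt0 expn_gt0 orbT.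
have : (i0%:R : R) <= q%:R by rewrite ler_nat ltnW.
rewrite 2!natrD 2!(natrM _ i) => /(ler_wpM2l (_ : 0 <= p')) H.
have := H ltac:(lra); move: ig; rewrite /g; lra.
Qed.

Lemma ae_leftmost_linear (p delta : R) : p_lo R <= p <= p_hi R -> rate p = 0 ->
  0 < delta <= 1 / 10 ->
  {ae P, forall w, exists C : R, exists N, forall k, (N <= k)%N ->
    `|leftmost j x0 (fun u => D u w) k - (ln 2 - p * ln 5) * k%:R|
      <= delta * ln 5 * k%:R + C}.
Proof.
move=> pb rp /andP[d0 d1].
have {pb} pb : 4 / 10 < p < 5 / 10 by move: pb; rewrite /p_lo /p_hi; lra.
have l5 : 0 <= ln 5 :> R by rewrite ln_ge0 //; lra.
have hi := @ae_eventually_miss (p + delta).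
have rd : rate (p + delta) < 0 by rewrite -rp; apply: rate_decr; lra.
have {}hi := hi ltac:(lra) rd.
have [A [r [rho [A0 rA rho01 Hrho]]]] :=
  @miss_supercritical p (p - delta) ltac:(lra) ltac:(lra) rp.
set q := (4 * 5 ^ j.-1)%N in Hrho.
have lo : {ae P, forall w, exists N, forall n, (N <= n)%N ->
    ~ (~` [set w | hit j (n * A + q) 1 (n * r) (D ^~ w)]) w}.
  apply: (@ae_eventually_not _ _ _ P _ 1 rho) => //.
    by move=> n; apply: measurableC; exact: (measurable_hit iidD).
  by move=> n; rewrite probability_miss // lee_fin mul1r.
apply: filterS2 hi lo => w [N1 H1] [N2 H2].
(* The constant absorbs the initial position, the rounding of the threshold, the delay q and an
   incomplete block of length A. *)
exists (`|x0| + ln 5 * (1 + q%:R + A%:R)), (maxn N1 (N2 * A + q)) => k.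
rewrite geq_max => /andP[k1 k2]; rewrite ler_norml.
have [x0l x0r] : - `|x0| <= x0 /\ x0 <= `|x0| by split; [rewrite lerNl -normrN|]; exact: ler_norm.
have dk : 0 <= delta * k%:R by rewrite mulr_ge0 // ltW.
apply/andP; split.
  have /negP nh := H1 k k1; have := leftmost_ge_miss x0 nh.
  set m := Num.truncn _; rewrite -natr1.
  have m1 : m%:R <= (p + delta) * k%:R.
    by have /andP[] := @truncn_itv R ((p + delta) * k%:R) ltac:(rewrite mulr_ge0 //; lra).
  have := ler_wpM2r l5 m1.
  have : 0 <= ln 5 * (q%:R + A%:R) :> R by rewrite mulr_ge0.
  by lra.
set n := ((k - q) %/ A)%N.
have [n2 nk kn] := divn_sub_bounds A0 k2; rewrite -/n in n2 nk kn.
have /contrapT hn := H2 n n2.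
have := leftmost_le_hit x0 (hit_leq nk hn); rewrite natrM => L.
have kn' : k%:R <= n%:R * A%:R + q%:R + A%:R :> R by rewrite -natrM -!natrD ler_nat.
have nr : (p - delta) * (k%:R - q%:R - A%:R) <= n%:R * r%:R.
  apply: (@le_trans _ _ ((p - delta) * (n%:R * A%:R))); first by rewrite ler_wpM2l; lra.
  by rewrite mulrCA ler_wpM2l.
have := ler_wpM2r l5 nr.
have : (p - delta) * (ln 5 * (q%:R + A%:R)) <= 1 * (ln 5 * (q%:R + A%:R)).
  by rewrite ler_wpM2r ?mulr_ge0 //; lra.
by lra.
Qed.

Lemma ae_cvg_leftmost (p : R) : p_lo R <= p <= p_hi R -> rate p = 0 ->
  {ae P, forall w : T,
    (fun k : nat => leftmost j x0 (fun u => D u w) k / k%:R) @ \oo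
      --> ln 2 - p * ln 5}.
Proof.
move=> pb rp.
have l5 : 0 < ln 5 :> R by rewrite ln_gt0 //; lra.
(* Countably many tolerances tending to 0, so that one null set serves them all. *)
pose delta (n : nat) : R := 10^-1 / n.+1%:R.
have del n : 0 < delta n <= 1 / 10.
  by rewrite divr_gt0 //= div1r ler_piMr // invf_le1 // ler1n.
have := ae_foralln (fun n => ae_leftmost_linear pb rp (del n)).
apply: filterS => w H; apply/cvgrPdist_le => e e0.
pose n := Num.truncn (ln 5 / e).
have dn : delta n * ln 5 <= e / 2.
  have : ln 5 / e < n.+1%:R by exact: truncnS_gt.
  rewrite ltr_pdivrMr // => Hn; rewrite /delta mulrAC ler_pdivrMr //.
  by move: (ltW Hn) (ltW e0) => ? ?; lra.
have [C [N HC]] := H n.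
pose M := maxn N (Num.truncn (2 * C / e)).+1.
exists M => // k /= Mk.
have k0 : 0 < k%:R :> R by rewrite ltr0n; move: Mk; rewrite /M; lia.
have Nk : (N <= k)%N by move: Mk; rewrite /M; lia.
have Ck : C <= e / 2 * k%:R.
  have : 2 * C / e < k%:R.
    apply: lt_le_trans (truncnS_gt _) _; rewrite ler_nat.
    by move: Mk; rewrite /M geq_max => /andP[].
  by rewrite ltr_pdivrMr // => ?; lra.
rewrite distrC -[X in _ - X](mulfK (lt0r_neq0 k0)) -mulrBl normrM normfV (gtr0_norm k0).
rewrite ler_pdivrMr //; apply: le_trans (HC k Nk) _.
have := ler_wpM2r (ltW k0) dn; lra.
Qed.

End AlmostSure.

Theorem theorem8p8 (R : realType) :
  exists beta : R,
    [/\ 0 < beta /\ gbar5BP beta = 0%E,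
        forall b : R, 0 < b -> gbar5BP b = 0%E -> b = beta,
        `|beta - (1179 / 10 ^+ 5 + 816 / 10 ^+ 8)| < 5 / 10 ^+ 9 &
        forall (j : nat) (d : measure_display) (T : measurableType d)
          (P : probability T R) (x0 : R) (D : seq bool -> T -> 'I_5),
          (1 <= j)%N -> iid_uniform_digits P D ->
          {ae P, forall w : T,
            (fun k : nat => leftmost j x0 (fun u => D u w) k / k%:R) @ \oo
              --> beta}].
Proof.
have [p pb rp] := rate_root R.
have p01 : 1 / 6 < p < 1 by move: pb; rewrite /p_lo /p_hi; lra.
have approx := root_approx pb.
exists (ln 2 - p * ln 5); split=> //.
- split; last exact: gbar5BP_root.
  move: approx; rewrite ltr_norml => /andP[+ _].
  set b := ln 2 - p * ln 5; set c := (X in b - X).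
  have : 5 / 10 ^+ 9 < c by rewrite /c; lra.
  by lra.
- by move=> b _; exact: gbar5BP_root_unique.
by move=> j d T P x0 D j1 iidD; exact: ae_cvg_leftmost.
Qed.
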